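(* Let $t>1$, $s>0$ and $$D_{s,t}=\Bigl\{x\in\mathbb R\setminus\mathbb Q:\ \sum_{n\ge1}\frac{1}{n^{s}|\sin(\pi nx)|^{t}}=+\infty\Bigr\}.$$ Then the Hausdorff dimension of $D_{s,t}$ is $$\dim_{\mathcal H}D_{s,t}=\min\Bigl\{1,\frac{2t}{s+t}\Bigr\}.$$ Moreover $D_{s,t}=\mathbb R\setminus\mathbb Q$ when $s\le t$, while for $s>t$ the set $D_{s,t}$ is dense in $\mathbb R$, of Lebesgue measure zero, and of Hausdorff dimension $2t/(s+t)\in(0,1)$. In particular, $\dim_{\mathcal H}D_{3,2}=\tfrac45$.
   Context: $\dim_{\mathcal H}$ denotes Hausdorff dimension of subsets of $\mathbb R$. *)

(* Defs.v *)
From mathcomp Require Import all_boot all_order all_algebra.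
From mathcomp Require Import all_classical all_reals all_analysis.

Set Implicit Arguments.
Unset Strict Implicit.
Unset Printing Implicit Defensive.

Import Order.TTheory GRing.Theory Num.Theory.
Import numFieldNormedType.Exports.

Local Open Scope classical_set_scope.
Local Open Scope ring_scope.

Section Hausdorff.
Context {R : realType}.
Implicit Types (A U : set R) (d delta : R).

(* The maximum with 0 only matters for the empty set, whose supremum in \bar R
   would otherwise be -oo. *)
Definition diameter U : \bar R :=
  maxe 0%E (ereal_sup [set (`|x - y|)%:E | x in U & y in U]).

(* The empty set has gauge 0 for every d, including d = 0 where diam^0 = 1 on
   nonempty sets; hence a countable cover may be padded with empty sets to
   represent a finite one. *)
Definition hausdorff_gauge d U : \bar R :=
  (if U == set0 then 0 else diameter U `^ d)%E.

Definition delta_cover delta A : set ((set R)^nat) :=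
  [set U | A `<=` \bigcup_k U k /\ forall k, (diameter (U k) <= delta%:E)%E].

Definition hausdorff_content d delta A : \bar R :=
  ereal_inf [set (\sum_(k <oo) hausdorff_gauge d (U k))%E
            | U in delta_cover delta A].

(* The limit as delta tends to 0 is the supremum over delta > 0, since
   hausdorff_content is nonincreasing in delta. *)
Definition hausdorff_measure d A : \bar R :=
  ereal_sup [set hausdorff_content d delta A | delta in [set e : R | 0 < e]].

Definition hausdorff_dim A : \bar R :=
  ereal_inf [set d%:E | d in [set d : R | 0 <= d /\
                                          hausdorff_measure d A = 0%E]].

End Hausdorff.

(* The terms are nonnegative, so the series in \bar R always has a value and is
   +oo exactly when it diverges. For irrational x no sine vanishes, so the
   convention 0^-1 = 0 is never used. *)
Definition sine_div_set {R : realType} (s t : R) : set R :=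
  [set x | irrational x /\
    (\sum_(1 <= n <oo) ((n%:R `^ s * `|sin (pi * n%:R * x)| `^ t)^-1)%:E
     = +oo)%E].

(* Main.v *)
Require Import Defs.
From mathcomp Require Import all_boot all_order all_algebra.
From mathcomp Require Import all_classical all_reals all_analysis.
From mathcomp Require Import zify ring lra.

(** Write [tau = max(2, 1 + s/t)]; the dimension is [2/tau]. An approximation
    [|q x - p| <= q^(-s/t)] makes the q-th term bounded below, so infinitely many
    of them force divergence. Conversely, if [|n x - p| >= c n^(-sigma)] for all n
    and p, with [sigma t < s], then in a dyadic block the fractional parts of the
    [n x] are separated from 0 and from each other, and as [t > 1] the block sums
    decay geometrically. Thus the divergence set lies between two limsup sets of
    Jarnik-Besicovitch type.

    The upper bound is the obvious cover by the intervals around [p/q]. For the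
    lower bound no measure is built: given intervals with small total d-weight,
    a nested sequence of intervals [[p/q + theta/2, p/q + theta]], with
    [theta = Q^-tau] and [q <= Q], is chosen so that the normalised weight of the
    given intervals meeting the current one stays at most 1. About [l Q^2]
    candidates, [Q^-2]-separated, are available inside an interval of length l,
    and the average over them of the new weight is small. The common point is
    irrational, well approximable and outside all given intervals. *)

Set Implicit Arguments.
Unset Strict Implicit.
Unset Printing Implicit Defensive.

Import Order.TTheory GRing.Theory Num.Theory.
Import numFieldNormedType.Exports.
Local Open Scope classical_set_scope.
Local Open Scope ring_scope.

(** * Comparison of |sin(pi n x)| with the distance from n x to an integer *)

Section Trigonometry.
Context {R : realType}.
Implicit Types (x y z : R) (m p : int) (n q : nat).

Lemma normr_sinDpi z m : `|sin (z + m%:~R * pi)| = `|sin z|.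
Proof.
have nat_case n w : `|sin (w + n%:R * pi)| = `|sin w|.
  elim: n => [|n IHn]; first by rewrite mul0r addr0.
  by rewrite -natr1 mulrDl mul1r addrA sinDpi normrN IHn.
case: m => n; first exact: nat_case.
rewrite -[in RHS](subrK (n.+1%:R * pi) z) nat_case NegzE mulrNz mulNr.
by rewrite -pmulrn.
Qed.

Lemma normr_sin_pi_intB n x p :
  `|sin (pi * n%:R * x)| = `|sin (pi * (n%:R * x - p%:~R))|.
Proof.
rewrite -[LHS](normr_sinDpi _ (- p)); congr (`|sin _|).
by rewrite mulrNz; ring.
Qed.

Lemma sin_MVT z : 0 < z -> exists2 c, 0 < c < z & sin z = cos c * z.
Proof.
move=> z0; have [|c] := @MVT R sin cos 0 z z0 (fun w _ => is_derive_sin w).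
  exact/continuous_subspaceT/continuous_sin.
by rewrite in_itv /= sin0 !subr0 => cz ->; exists c.
Qed.

Lemma ler_normr_sin z : `|sin z| <= `|z|.
Proof.
wlog z0 : z / 0 < z => [hw|].
  have [z0|z0|<-] := ltgtP 0 z; first exact: hw.
  - by rewrite -(normrN z) -(normrN (sin z)) -sinN; apply: hw; rewrite oppr_gt0.
  - by rewrite sin0 normr0.
have [c _ ->] := sin_MVT z0.
by rewrite normrM ler_piMl // ler_norml cos_geN1 cos_le1.
Qed.

(** For z > 0, sin z = 2 sin(z/2) cos(z/2) and sin(z/2) = cos c * z/2 with 0 < c < z/2, so sin z >=
    z cos(z/2)^2; and cos(z/2)^2 = (1 + cos z)/2 >= 1/2. *)
Lemma ler_half_normr_sin z : `|z| <= pi / 2 -> `|z| / 2 <= `|sin z|.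
Proof.
wlog z0 : z / 0 < z => [hw|].
  have [z0|z0|<-] := ltgtP 0 z; first exact: hw.
  - move=> zpi; rewrite -(normrN z) -(normrN (sin z)) -sinN.
    by apply: hw; rewrite ?normrN ?oppr_gt0.
  - by rewrite sin0 normr0 mul0r.
rewrite (gtr0_norm z0) => zpi.
have z20 : 0 < z / 2 by lra.
have [c /andP[c0 cz] sE] := sin_MVT z20.
have pi0 : (0 : R) < pi := pi_gt0 R.
have cosz : 0 <= cos z.
  by apply: cos_ge0_pihalf; apply/andP; split => //; lra.
have h2 : cos z = cos (z / 2) ^+ 2 *+ 2 - 1.
  by rewrite [in LHS](splitr z) cosD -!expr2 sin2cos2; ring.
have cosz2 : 0 <= cos (z / 2).
  by apply: cos_ge0_pihalf; apply/andP; split; lra.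
have coscz : cos (z / 2) <= cos c.
  rewrite leNgt; apply/negP; rewrite ltr_cos ?in_itv /=; lra.
have s2 : sin z = (sin (z / 2) * cos (z / 2)) *+ 2.
  by rewrite [in LHS](splitr z) sinD; ring.
apply: le_trans (ler_norm _); rewrite s2 sE.
have h3 : 1 / 2 <= cos (z / 2) ^+ 2 by move: cosz; rewrite h2; lra.
have h4 : cos (z / 2) ^+ 2 <= cos c * cos (z / 2).
  by rewrite expr2 ler_wpM2r.
by nra.
Qed.

Lemma normr_sin_pi_le n x p :
  `|sin (pi * n%:R * x)| <= pi * `|n%:R * x - p%:~R|.
Proof.
rewrite (normr_sin_pi_intB n x p) (le_trans (ler_normr_sin _)) //.
by rewrite normrM gtr0_norm ?pi_gt0.
Qed.

Lemma normr_sin_pi_ge n x p :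
  `|n%:R * x - p%:~R| <= 2^-1 ->
  `|n%:R * x - p%:~R| <= `|sin (pi * n%:R * x)|.
Proof.
move=> h; rewrite (normr_sin_pi_intB n x p).
(* The factor 1/2 in [ler_half_normr_sin] is absorbed by pi >= 2. *)
have pi2 := pi_ge2 R.
have := @ler_half_normr_sin (pi * (n%:R * x - p%:~R)).
rewrite normrM (@gtr0_norm _ pi) ?pi_gt0 //.
set u := `|_| in h * => H; have u0 : 0 <= u by exact: normr_ge0.
apply: le_trans (H _); nra.
Qed.

End Trigonometry.

(** * Approximation of irrationals by rationals *)

Section Approximation.
Context {R : realType}.
Implicit Types (x c sigma : R) (p : int) (n q N : nat).

(** Multiplied-out form of |x - p/q| <= q^-(1 + sigma) for unboundedly many q; the fractions need
    not be reduced. *)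
Definition approximable sigma : set R :=
  [set x | forall N, exists q p,
    (N <= q)%N /\ `|q%:R * x - p%:~R| <= q%:R `^ (- sigma)].

Lemma irrational_mulrn_neq x q p :
  irrational x -> (0 < q)%N -> q%:R * x - p%:~R != 0.
Proof.
move=> irrx q0; apply/eqP => /subr0_eq e; apply: irrx; apply/rationalP.
by exists p, q; rewrite -e mulrAC mulfV ?mul1r // pnatr_eq0 -lt0n.
Qed.

(** Used to force large denominators: an error below [c] rules out q <= N. For each q only the two
    integers around q x matter. *)
Lemma irrational_gap x N : irrational x -> exists2 c, 0 < c &
  forall q p, (0 < q <= N)%N -> c <= `|q%:R * x - p%:~R|.
Proof.
move=> irrx; elim: N => [|N [c c0 cP]].
  by exists 1 => // q p /andP[/leq_trans H /H].
set y := N.+1%:R * x; pose f : R := (Num.floor y)%:~R.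
have fy : f < y.
  rewrite lt_neqAle floor_le andbT -subr_eq0 -oppr_eq0 opprB.
  exact: irrational_mulrn_neq.
have yf : y < f + 1 by have := floorD1_gt y; rewrite intrD.
exists (Num.min c (Num.min (y - f) (f + 1 - y))).
  by rewrite !lt_min c0 /=; lra.
move=> q p /andP[q0]; rewrite leq_eqVlt => /predU1P[->|qN]; last first.
  by apply: le_trans (cP q p _); rewrite ?ge_min ?lexx // q0.
rewrite -/y ge_min; apply/orP; right; rewrite ge_min.
have [pf|] := leP p (Num.floor y).
  have {}pf : p%:~R <= f by rewrite ler_int.
  by apply/orP; left; rewrite ger0_norm; lra.
rewrite -lezD1 => {}pf; have {pf} : f + 1 <= p%:~R.
  by rewrite /f -[1]/(1%:~R) -intrD ler_int.
by move=> pf; apply/orP; right; rewrite ler0_norm; lra.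
Qed.

(** Pigeonhole: the N + 1 fractional parts of n x, 0 <= n <= N, fall into N boxes of length 1/N, and
    q is the difference of two indices sharing a box. *)
Lemma dirichlet x N : (0 < N)%N ->
  exists q p, (0 < q <= N)%N /\ `|q%:R * x - p%:~R| < N%:R^-1.
Proof.
move=> N0; have NR : (0 : R) < N%:R by rewrite ltr0n.
pose f n : R := (Num.floor (n%:R * x))%:~R.
have fE n : 0 <= n%:R * x - f n < 1.
  by have := floor_le (n%:R * x); have := floorD1_gt (n%:R * x);
     rewrite intrD -/(f n) => ? ?; apply/andP; split; lra.
pose g n := Num.trunc (N%:R * (n%:R * x - f n)).
have gP n : (g n)%:R <= N%:R * (n%:R * x - f n) < (g n).+1%:R.
  by apply: truncn_itv; rewrite mulr_ge0 // ?(ltW NR) //; case/andP: (fE n).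
have gN n : (g n < N)%N.
  have /andP[gl _] := gP n; have /andP[_ f1] := fE n.
  by rewrite -(ltr_nat R) (le_lt_trans gl) // gtr_pMr.
have /injectivePn[i [j ij /(congr1 val) /= gij]] :
    ~~ injectiveb (fun i : 'I_N.+1 => Ordinal (gN i)).
  apply/negP => /injectiveP /leq_card; by rewrite !card_ord ltnn.
wlog lij : i j ij gij / (i < j)%N.
  move=> hw; have [/hw|/hw|/val_inj] := ltngtP i j; try exact.
    by move=> H; apply: H; rewrite // eq_sym.
  by move/eqP; rewrite (negPf ij).
exists (j - i)%N, (Num.floor (j%:R * x) - Num.floor (i%:R * x)).
split; first by rewrite subn_gt0 lij (leq_trans (leq_subr _ _)) // -ltnS.
have := gP i; have := gP j; rewrite -gij.
rewrite natrB ?(ltnW lij) // intrB -/(f j) -/(f i) -natr1.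
set G : R := (g i)%:R => /andP[h1 h2] /andP[h3 h4].
rewrite -(ltr_pM2l NR) mulfV ?gt_eqF // -[N%:R in ltLHS](gtr0_norm NR) -normrM.
by rewrite ltr_norml; apply/andP; split; nra.
Qed.

Lemma irrational_approximable x : irrational x -> approximable 1 x.
Proof.
move=> irrx N; have [c c0 cP] := irrational_gap N irrx.
(* With 1/M <= c, an approximation of error below 1/M has q > N, and q <= M bounds the error by
   1/q. *)
have [M M0 cM] : exists2 M, (0 < M)%N & M%:R^-1 <= c.
  exists (Num.trunc c^-1).+1 => //.
  rewrite -[leRHS]invrK lef_pV2 ?posrE ?ltr0n ?invr_gt0 //.
  by rewrite ltW // truncnS_gt.
have [q [p [/andP[q0 qM] qp]]] := dirichlet x M0.
exists q, p; split.
  rewrite leqNgt; apply/negP => qN.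
  have := cP q p; rewrite q0 (ltnW qN) => /(_ erefl).
  by rewrite leNgt (lt_le_trans qp).
rewrite powR_inv1 ?ler0n // (le_trans (ltW qp)) //.
by rewrite lef_pV2 ?posrE ?ltr0n // ler_nat.
Qed.

End Approximation.

(** * Bounds for series with nonnegative terms and for sums over separated points *)

Section Series.
Context {R : realType}.
Implicit Types (a : nat -> R) (b c r s t x y z delta rho sigma : R).
Implicit Types (p : int) (j k m n q N : nat).

Lemma nneseries_le a m b : (forall k, 0 <= a k) ->
  (forall n, \sum_(m <= k < n) a k <= b) ->
  (\sum_(m <= k <oo) (a k)%:E <= b%:E)%E.
Proof.
move=> a0 ab; apply: lime_le.
  by apply: is_cvg_nneseries => k _ _; rewrite lee_fin.
by apply: nearW => n; rewrite sumEFin lee_fin.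
Qed.

Lemma nneseries_ge a m n b : (forall k, 0 <= a k) ->
  b <= \sum_(m <= k < n) a k -> (b%:E <= \sum_(m <= k <oo) (a k)%:E)%E.
Proof.
move=> a0 ab; apply: (@le_trans _ _ (\sum_(m <= k < n) (a k)%:E)%E).
  by rewrite sumEFin lee_fin.
by apply: nneseries_lim_ge => k _ _; rewrite lee_fin.
Qed.

Lemma nneseries_pinfty_io a m c : (forall k, 0 <= a k) -> 0 < c ->
  (forall N, exists2 k, (N <= k)%N & c <= a k) ->
  (\sum_(m <= k <oo) (a k)%:E = +oo)%E.
Proof.
move=> a0 c0 io; apply/eqyP => b b0.
have large n : exists2 N, (m <= N)%N & n%:R * c <= \sum_(m <= k < N) a k.
  elim: n => [|n [N mN IHn]].
    by exists m => //; rewrite mul0r big_geq.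
  have [k Nk ck] := io N; exists k.+1; first by rewrite (leq_trans mN) // leqW.
  rewrite (big_cat_nat (n := N)) //=; last exact: leqW.
  rewrite -natr1 mulrDl mul1r lerD // big_nat_recr //= (le_trans ck) //.
  by rewrite lerDr sumr_ge0.
have [N _ hN] := large (Num.trunc (b / c)).+1.
apply: (nneseries_ge a0); apply: le_trans hN.
by rewrite -ler_pdivrMr // ltW // truncnS_gt.
Qed.

Lemma ler_sum_nat_dyadic a b r : (forall k, 0 <= a k) -> 0 <= b -> 0 <= r < 1 ->
  (forall j, \sum_(2 ^ j <= k < 2 ^ j.+1) a k <= b * r ^+ j) ->
  forall n, \sum_(1 <= k < n) a k <= b / (1 - r).
Proof.
move=> a0 b0 /andP[r0 r1] ab n.
(* The geometric sum, multiplied by 1 - r so that the induction involves no division. *)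
have dyadic m : (1 - r) * \sum_(1 <= k < 2 ^ m) a k <= b * (1 - r ^+ m).
  elim: m => [|m IHm]; first by rewrite big_geq // !(expr0,subrr,mulr0).
  rewrite (big_cat_nat (n := 2 ^ m)) ?expn_gt0 ?leq_exp2l //= mulrDr exprS.
  have r1' : 0 <= 1 - r by lra.
  have := ler_wpM2l r1' (ab m); lra.
have n2 : (n <= 2 ^ n)%N by exact/ltnW/ltn_expl.
rewrite ler_pdivlMr ?subr_gt0 // mulrC.
apply: (@le_trans _ _ ((1 - r) * \sum_(1 <= k < 2 ^ n) a k)).
  rewrite ler_wpM2l ?subr_ge0 ?(ltW r1) //.
  case: n {dyadic} n2 => [|n] n2; first by rewrite big_geq // sumr_ge0.
  by rewrite [leRHS](big_cat_nat (n := n.+1)) //= lerDl sumr_ge0.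
by rewrite (le_trans (dyadic n)) // ler_piMr // gerBl exprn_ge0.
Qed.

Lemma ler_sum_uniq_sub (I : eqType) (u v : seq I) (F : I -> R) :
  (forall i, 0 <= F i) -> uniq u -> {subset u <= v} ->
  \sum_(i <- u) F i <= \sum_(i <- v) F i.
Proof.
move=> F0; elim: u v => [|i u IHu] v /=.
  by move=> _ _; rewrite big_nil sumr_ge0.
move=> /andP[iu uu] uv; have iv : i \in v by rewrite uv ?mem_head.
rewrite (perm_big _ (perm_to_rem iv)) !big_cons lerD2l IHu // => k ku.
have kv : k \in v by rewrite uv // in_cons ku orbT.
have ki : k != i by apply: contraNneq iu => <-.
by move: kv; rewrite (perm_mem (perm_to_rem iv)) in_cons (negPf ki).
Qed.

Lemma powR_expn2 s j : (2 ^ j)%:R `^ s = (2 `^ s) ^+ j :> R.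
Proof.
elim: j => [|j IHj]; first by rewrite powR1.
by rewrite expnS natrM powRM ?ler0n // IHj exprS.
Qed.

Lemma gt0_powRD x b c : 0 < x -> x `^ (b + c) = x `^ b * x `^ c.
Proof. by move=> x0; rewrite powRD ?(lt0r_neq0 x0) ?implybT. Qed.

Lemma powR_large c b : 0 < b -> exists N, forall n, (N <= n)%N -> c <= n%:R `^ b.
Proof.
move=> b0; exists (Num.trunc (`|c| `^ b^-1)).+1 => n Nn.
apply: le_trans (ler_norm c) _.
rewrite [leLHS](_ : _ = (`|c| `^ b^-1) `^ b); last first.
  by rewrite -powRrM mulVf ?lt0r_neq0 // powRr1.
rewrite ge0_ler_powR ?nnegrE ?powR_ge0 ?ler0n ?(ltW b0) //.
by rewrite (le_trans (ltW (truncnS_gt _))) // ler_nat.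
Qed.

Lemma powR2_lt1 s : s < 0 -> 0 <= 2 `^ s < 1.
Proof.
move=> s0; rewrite powR_ge0 /= -[ltRHS](powRr0 2).
by rewrite /powR !pnatr_eq0 /= ltr_expR ltr_pM2r // ln_gt0 // ltr1n.
Qed.

Lemma powRN_le s x y : 0 <= s -> 0 < x -> x <= y -> y `^ (- s) <= x `^ (- s).
Proof.
move=> s0 x0 xy; have y0 := lt_le_trans x0 xy.
rewrite !powRN lef_pV2 ?posrE ?powR_gt0 //.
by rewrite ge0_ler_powR ?nnegrE ?(ltW x0) ?(ltW y0).
Qed.

Lemma zeta_bounded t : 1 < t ->
  exists2 b, 0 < b & forall n, \sum_(1 <= k < n) k%:R `^ (- t) <= b.
Proof.
move=> t1; have r1 := @powR2_lt1 (1 - t).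
have {}r1 : 0 <= 2 `^ (1 - t) < 1 by apply: r1; lra.
exists (1 / (1 - 2 `^ (1 - t))); first by rewrite divr_gt0 // subr_gt0; case/andP: r1.
apply: ler_sum_nat_dyadic => // j.
rewrite mul1r -powR_expn2 powRD; last by rewrite pnatr_eq0 expn_eq0 implybT.
rewrite powRr1 ?ler0n //.
apply: (@le_trans _ _ (\sum_(2 ^ j <= k < 2 ^ j.+1) (2 ^ j)%:R `^ (- t))).
  apply: ler_sum_nat => k /andP[jk _]; apply: powRN_le; first lra.
    by rewrite ltr0n expn_gt0.
  by rewrite ler_nat.
by rewrite sumr_const_nat expnS mul2n -addnn addnK mulr_natl.
Qed.

Definition separated delta (ys : seq R) :=
  {in ys &, forall y z, y != z -> delta <= `|y - z|}.

(** The map sends a point to the index of its cell of length [delta] counted from [b]; points of one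
    cell are less than [delta] apart. *)
Lemma separated_trunc_inj delta b ys : 0 < delta -> separated delta ys ->
  {in ys, forall y, b <= y} ->
  {in ys &, injective (fun y => Num.trunc ((y - b) / delta))}.
Proof.
move=> d0 sep yb y z yin zin /= e; apply/eqP/negPn/negP => yz.
have := sep _ _ yin zin yz.
have trP w : w \in ys -> (Num.trunc ((w - b) / delta))%:R * delta <= w - b <
    (Num.trunc ((w - b) / delta)).+1%:R * delta.
  move=> win; rewrite -ler_pdivlMr // -ltr_pdivrMr //; apply: truncn_itv.
  by rewrite divr_ge0 ?(ltW d0) // subr_ge0 yb.
have := trP y yin; have := trP z zin; rewrite e.
set k := Num.trunc _; have kS : k.+1%:R * delta = k%:R * delta + delta.
  by rewrite -natr1; ring.
rewrite kS => /andP[h1 h2] /andP[h3 h4]; rewrite leNgt => /negP; apply.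
by rewrite ltr_norml; apply/andP; split; lra.
Qed.

(** The index k = floor(y/delta) is at least 1, differs from point to point and satisfies y >= k
    delta, so the sum is at most delta^-t times a partial sum of zeta(t). *)
Lemma sum_separated_pos t : 1 < t -> exists2 b, 0 < b & forall delta ys,
  0 < delta -> uniq ys -> separated delta ys -> {in ys, forall y, delta <= y} ->
  \sum_(y <- ys) y `^ (- t) <= b * delta `^ (- t).
Proof.
move=> t1; have [b b0 bP] := zeta_bounded t1; exists b => // delta ys d0 uys sep yd.
have inj := separated_trunc_inj (b := 0) d0 sep.
pose f y := Num.trunc ((y - 0) / delta).
have {}inj : {in ys &, injective f}.
  by apply: inj => y yin; rewrite (le_trans (ltW d0)) ?yd.
have f1 y : y \in ys -> (0 < f y)%N /\ (f y)%:R * delta <= y.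
  move=> yin; have yd1 := yd y yin.
  have yd0 : 0 <= y / delta by rewrite divr_ge0 ?(ltW d0) // (le_trans (ltW d0)).
  have /andP[h1 h2] := truncn_itv yd0.
  rewrite /f subr0; split; last by rewrite -ler_pdivlMr.
  by rewrite truncn_gt0 ler_pdivlMr // mul1r.
apply: (@le_trans _ _ (\sum_(y <- ys) (f y)%:R `^ (- t) * delta `^ (- t))).
  rewrite big_seq [leRHS]big_seq; apply: ler_sum => y yin.
  have [f0 fy] := f1 y yin.
  rewrite -powRM ?ler0n ?(ltW d0) //; apply: powRN_le => //; first lra.
  by rewrite mulr_gt0 // ltr0n.
rewrite -mulr_suml ler_wpM2r ?powR_ge0 //.
rewrite -(big_map f predT (fun k => k%:R `^ (- t))).
pose M := (\max_(k <- [seq f y | y <- ys]) k).+1.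
apply: le_trans (bP M).
apply: ler_sum_uniq_sub => [k||k kin]; first exact: powR_ge0.
  by rewrite map_inj_in_uniq.
rewrite mem_index_iota ltnS; case/mapP: (kin) => y yin kE.
rewrite {1}kE; case: (f1 y yin) => -> _ /=.
exact: (@leq_bigmax_seq _ _ predT id).
Qed.

Lemma sum_separated t : 1 < t -> exists2 b, 0 < b & forall delta ys,
  0 < delta -> uniq ys -> separated delta ys ->
  {in ys, forall y, delta <= `|y|} ->
  \sum_(y <- ys) `|y| `^ (- t) <= b * delta `^ (- t).
Proof.
move=> t1; have [b b0 bP] := sum_separated_pos t1.
exists (b + b) => [|delta ys d0 uys sep yd]; first exact: addr_gt0.
rewrite (bigID (fun y => 0 <= y)) /= mulrDl; apply: lerD.
  rewrite -big_filter big_seq (eq_bigr (fun y => y `^ (- t))) => [|y]; last first.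
    by rewrite mem_filter => /andP[y0 _]; rewrite ger0_norm.
  rewrite -big_seq; apply: bP => //; first exact: filter_uniq.
    by move=> y z; rewrite !mem_filter => /andP[_ yin] /andP[_ zin]; exact: sep.
  by move=> y; rewrite mem_filter => /andP[y0 /yd]; rewrite ger0_norm.
rewrite -big_filter big_seq (eq_bigr (fun y => (- y) `^ (- t))) => [|y]; last first.
  by rewrite mem_filter -ltNge => /andP[y0 _]; rewrite ltr0_norm.
rewrite -big_seq -(big_map -%R predT (fun y => y `^ (- t))).
apply: bP => //.
- by rewrite (map_inj_uniq oppr_inj) filter_uniq.
- move=> _ _ /mapP[y yin ->] /mapP[z zin ->]; rewrite eqr_opp => yz.
  move: yin zin; rewrite !mem_filter => /andP[_ yin] /andP[_ zin].
  by rewrite -opprD normrN sep.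
- move=> _ /mapP[y yin ->]; move: yin; rewrite mem_filter -ltNge.
  by move=> /andP[y0 /yd]; rewrite ltr0_norm.
Qed.

End Series.

(** * The sine series and the quality of approximation *)

Section SineSeries.
Context {R : realType}.
Implicit Types (s t x y z c sigma : R) (p : int) (j k m n q N : nat).

Lemma nearest_int z : exists p, `|z - p%:~R| <= 2^-1.
Proof.
exists (Num.floor (z + 2^-1)).
have := floor_le (z + 2^-1); have := floorD1_gt (z + 2^-1).
rewrite intrD => h1 h2; rewrite ler_norml; apply/andP; split; lra.
Qed.

Lemma normr_sin_pi_gt0 x n : irrational x -> (0 < n)%N ->
  0 < `|sin (pi * n%:R * x)|.
Proof.
move=> irrx n0; have [p np] := nearest_int (n%:R * x).
apply: lt_le_trans (normr_sin_pi_ge np).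
by rewrite normr_gt0 irrational_mulrn_neq.
Qed.

Lemma approximable_sub sigma sigma' : sigma' <= sigma ->
  @approximable R sigma `<=` approximable sigma'.
Proof.
move=> ss x ax N; have [q [p [Nq qp]]] := ax (maxn N 1).
exists q, p; move: Nq; rewrite geq_max => /andP[Nq q1]; split => //.
by apply: le_trans qp _; rewrite ler_powR ?ler1n // lerN2.
Qed.

(** At a good denominator q the sine is at most pi q^(-s/t), so the q-th term is at least pi^-t. *)
Lemma approximable_sine_div s t x : 0 < s -> 1 < t ->
  irrational x -> approximable (s / t) x -> sine_div_set s t x.
Proof.
move=> s0 t1 irrx ax; split => //; have t0 : 0 < t by lra.
apply: (@nneseries_pinfty_io _ _ _ (pi `^ t)^-1) => [k||N].
- by rewrite invr_ge0 mulr_ge0 ?powR_ge0.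
- by rewrite invr_gt0 powR_gt0 ?pi_gt0.
have [q [p [Nq qp]]] := ax (maxn N 1); move: Nq; rewrite geq_max => /andP[Nq q1].
exists q => //; have q0 : (0 : R) < q%:R by rewrite ltr0n.
have sin0 := normr_sin_pi_gt0 irrx q1.
rewrite lef_pV2 ?posrE ?mulr_gt0 ?powR_gt0 ?pi_gt0 //.
have qs : q%:R `^ s = (q%:R `^ (s / t)) `^ t.
  by rewrite -powRrM divfK // gt_eqF.
rewrite qs -powRM ?powR_ge0 // ge0_ler_powR ?nnegrE ?(ltW t0) ?pi_ge0
  ?mulr_ge0 ?powR_ge0 //.
rewrite -ler_pdivlMl ?powR_gt0 // -powRN [leRHS]mulrC.
apply: le_trans (normr_sin_pi_le q x p) _.
by rewrite ler_wpM2l ?pi_ge0.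
Qed.

(** Beyond some N the negated definition gives the bound with constant 1; the finitely many smaller
    q are handled by [irrational_gap]. *)
Lemma not_approximable_gap x sigma : 0 <= sigma -> irrational x ->
  ~ approximable sigma x -> exists2 c, 0 < c &
  forall q p, (0 < q)%N -> c * q%:R `^ (- sigma) <= `|q%:R * x - p%:~R|.
Proof.
move=> s0 irrx /existsNP[N nax]; have [c c0 cP] := irrational_gap N irrx.
exists (Num.min c 1); first by rewrite lt_min c0 ltr01.
move=> q p q0; have [qN|Nq] := leqP q N.
  apply: le_trans (cP q p _); last by rewrite q0.
  apply: (@le_trans _ _ (c * 1)); last by rewrite mulr1.
  rewrite ler_pM ?le_min ?powR_ge0 ?(ltW c0) ?ler01 ?ge_min ?lexx //.
  by rewrite -[leRHS](powRr0 q%:R) ler_powR ?ler1n // oppr_le0.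
rewrite leNgt; apply/negP => lt; apply: nax; exists q, p; split; first exact: ltnW.
apply: le_trans (ltW lt) _.
by rewrite ler_piMl ?powR_ge0 // ge_min lexx orbT.
Qed.

(* On a dyadic block the points [n x - p_n] are at least [c (2N)^-sigma] away
   from 0 and from each other. *)
Lemma sine_block_le s t x sigma : 0 < s -> 1 < t -> 0 <= sigma ->
  irrational x -> ~ approximable sigma x -> exists2 c, 0 < c & forall j,
  \sum_(2 ^ j <= n < 2 ^ j.+1) (n%:R `^ s * `|sin (pi * n%:R * x)| `^ t)^-1
    <= c * (2 `^ (sigma * t - s)) ^+ j.
Proof.
move=> s0 t1 sig0 irrx nax.
have [c c0 cP] := not_approximable_gap sig0 irrx nax.
have [b b0 bP] := @sum_separated R t t1.
exists (b * (c * 2 `^ (- sigma)) `^ (- t)).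
  by rewrite !(mulr_gt0, powR_gt0).
move=> j; have [p pP] := choice (fun n => nearest_int (n%:R * x)).
pose y n := n%:R * x - (p n)%:~R.
pose delta := c * (2 ^ j.+1)%:R `^ (- sigma).
have delta0 : 0 < delta by rewrite mulr_gt0 // powR_gt0 // ltr0n expn_gt0.
have deltaP q p' : (0 < q <= 2 ^ j.+1)%N -> delta <= `|q%:R * x - p'%:~R|.
  move=> /andP[q0 q2]; apply: le_trans (cP q p' q0).
  by rewrite ler_wpM2l ?(ltW c0) // powRN_le ?ltr0n ?ler_nat.
pose I := index_iota (2 ^ j) (2 ^ j.+1).
have sep m n : m \in I -> n \in I -> m != n -> delta <= `|y m - y n|.
  wlog mn : m n / (n < m)%N => [hw|].
    move=> mI nI mn; have := mn; rewrite neq_ltn => /orP[|] h.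
      by rewrite distrC; apply: hw; rewrite // eq_sym.
    exact: hw.
  rewrite !mem_index_iota => /andP[_ m2] _ _.
  (* A difference of two points is again of the form q x - p with 0 < q < 2^(j+1), so the bound away
     from 0 also separates them. *)
  have -> : y m - y n = (m - n)%:R * x - (p m - p n)%:~R.
    by rewrite /y natrB ?(ltnW mn) // intrB; ring.
  by rewrite deltaP // subn_gt0 mn (leq_trans (leq_subr _ _)) // ltnW.
have yI : {in I &, injective y}.
  move=> m n mI nI e; apply/eqP/negPn/negP => /(sep _ _ mI nI).
  by rewrite e subrr normr0 leNgt delta0.
(* With N = 2^j, the factor n^s contributes N^-s and delta^-t contributes N^(sigma t): hence the
   ratio 2^(sigma t - s). *)
have -> : b * (c * 2 `^ (- sigma)) `^ (- t) * (2 `^ (sigma * t - s)) ^+ j =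
    (2 ^ j)%:R `^ (- s) * (b * delta `^ (- t)).
  have -> : delta = c * 2 `^ (- sigma) * (2 ^ j)%:R `^ (- sigma).
    by rewrite /delta expnS natrM powRM ?ler0n // mulrA.
  rewrite -powR_expn2 [in RHS]powRM ?mulr_ge0 ?powR_ge0 ?(ltW c0) //.
  rewrite -(powRrM (2 ^ j)%:R) mulrNN powRD; last first.
    by rewrite pnatr_eq0 expn_eq0 implybT.
  by ring.
apply: le_trans (ler_wpM2l (powR_ge0 _ _) (bP delta [seq y n | n <- I] _ _ _ _)).
- rewrite big_map mulr_sumr big_seq [leRHS]big_seq; apply: ler_sum => n nI.
  have := nI; rewrite mem_index_iota => /andP[n2 _].
  have n0 : (0 < n)%N by rewrite (leq_trans _ n2) // expn_gt0.
  rewrite invfM -!powRN; apply: ler_pM; rewrite ?powR_ge0 //.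
    by rewrite powRN_le ?(ltW s0) ?ltr0n ?expn_gt0 ?ler_nat.
  rewrite powRN_le ?normr_gt0 ?irrational_mulrn_neq ?normr_sin_pi_ge //; lra.
- exact: delta0.
- by rewrite map_inj_in_uniq // iota_uniq.
- move=> _ _ /mapP[m mI ->] /mapP[n nI ->] yy; apply: sep => //.
  by apply: contraNneq yy => ->.
- move=> _ /mapP[n nI ->]; apply: deltaP.
  move: nI; rewrite mem_index_iota => /andP[n2 /ltnW ->].
  by rewrite andbT (leq_trans _ n2) // expn_gt0.
Qed.

(** By contraposition: sigma t < s makes the ratio of the dyadic block bounds less than 1, so the
    series is finite. *)
Lemma sine_div_approximable s t sigma : 0 < s -> 1 < t -> 0 <= sigma ->
  sigma * t < s -> sine_div_set s t `<=` @approximable R sigma.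
Proof.
move=> s0 t1 sig0 sts x [irrx Dx]; apply: contrapT => nax.
have [c c0 cP] := sine_block_le s0 t1 sig0 irrx nax.
have r1 : sigma * t - s < 0 by lra.
have a0 n : 0 <= (n%:R `^ s * `|sin (pi * n%:R * x)| `^ t)^-1.
  by rewrite invr_ge0 mulr_ge0 ?powR_ge0.
have := nneseries_le a0 (ler_sum_nat_dyadic a0 (ltW c0) (powR2_lt1 r1) cP).
by rewrite Dx leye_eq.
Qed.

End SineSeries.

(** * Null sets for the Hausdorff measure *)

Section Covers.
Context {R : realType}.
Implicit Types (d e b delta sigma x : R) (A U : set R) (p : int) (k n m q N : nat).
Implicit Types (y r : nat -> R).

(** Nullity for the d-dimensional measure in terms of balls, without a mesh bound: for d > 0 a small
    total already forces every radius to be small. Radius 0 is allowed. *)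
Definition coverable d A := forall e, 0 < e -> exists y r,
  [/\ forall k, 0 <= r k,
      A `<=` \bigcup_k [set x | `|x - y k| <= r k]
    & forall n, \sum_(0 <= k < n) r k `^ d <= e].

Lemma diameter_ge0 U : (0 <= diameter U)%E.
Proof. by rewrite /diameter le_max lexx. Qed.

Lemma hausdorff_gauge_ge0 d U : (0 <= hausdorff_gauge d U)%E.
Proof. by rewrite /hausdorff_gauge; case: ifP => // _; exact: poweR_ge0. Qed.

Lemma diameter_ball_le x b : 0 <= b ->
  (diameter [set z : R | (`|z - x| <= b)%R] <= (2 * b)%:E)%E.
Proof.
move=> b0; rewrite /diameter ge_max lee_fin mulr_ge0 //=.
apply: ge_ereal_sup => _ [u /= ux] [v /= vx] <-.
rewrite lee_fin (_ : u - v = (u - x) - (v - x)); last by ring.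
by rewrite (le_trans (ler_normB _ _)) // mulr_natl mulr2n lerD.
Qed.

Lemma hausdorff_gauge_le d b U : 0 <= d -> 0 <= b ->
  (diameter U <= b%:E)%E -> (hausdorff_gauge d U <= (b `^ d)%:E)%E.
Proof.
move=> d0 b0 Ub; rewrite /hausdorff_gauge; case: ifP => _.
  by rewrite lee_fin powR_ge0.
rewrite -poweR_EFin gt0_ler_poweR ?in_itv //= ?diameter_ge0 ?lee_fin //=.
all: by rewrite ?b0 ?leey.
Qed.

Lemma hausdorff_content_ge0 d delta A : (0 <= hausdorff_content d delta A)%E.
Proof.
apply: le_ereal_inf_tmp => _ [U _ <-]; apply: nneseries_ge0 => k _ _.
exact: hausdorff_gauge_ge0.
Qed.

Lemma coverable_hausdorff_measure0 d A : 0 < d -> coverable d A ->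
  hausdorff_measure d A = 0%E.
Proof.
move=> d0 cA; apply/eqP; rewrite eq_le; apply/andP; split; last first.
  apply: ereal_sup_ge; exists (hausdorff_content d 1 A).
    by exists 1 => //=; exact: ltr01.
  exact: hausdorff_content_ge0.
apply: ge_ereal_sup => _ [delta /= delta0 <-]; apply/lee_addgt0Pr => e e0.
(* The first bound pays for the factor 2 between radius and diameter; the second forces each
   diameter 2 r_k below [delta]. *)
rewrite add0e; pose b := Num.min (e / 2 `^ d) ((delta / 2) `^ d).
have b0 : 0 < b by rewrite lt_min divr_gt0 ?powR_gt0 ?divr_gt0.
have [y [r [r0 Ay rb]]] := cA b b0.
apply: ereal_inf_le; pose U k := [set x | `|x - y k| <= r k].
exists (\sum_(0 <= k <oo) hausdorff_gauge d (U k))%E; last first.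
  apply: (@le_trans _ _ (\sum_(0 <= k <oo) ((2 * r k) `^ d)%:E)%E).
    apply: lee_nneseries => k _; first by move=> _; exact: hausdorff_gauge_ge0.
    by rewrite hausdorff_gauge_le ?mulr_ge0 ?diameter_ball_le ?(ltW d0).
  apply: nneseries_le => [k|n]; first exact: powR_ge0.
  under eq_bigr do rewrite powRM //.
  rewrite -mulr_sumr mulrC -ler_pdivlMr ?powR_gt0 //.
  by apply: le_trans (rb n) _; rewrite ge_min lexx.
exists U => //; split => // k; apply: le_trans (diameter_ball_le _ (r0 k)) _.
rewrite lee_fin -ler_pdivlMl // mulrC.
have rk : r k `^ d <= (delta / 2) `^ d.
  apply: le_trans (_ : b <= _); last by rewrite ge_min lexx orbT.
  apply: le_trans (rb k.+1); rewrite big_nat_recr //= lerDr.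
  by rewrite sumr_ge0 // => *; exact: powR_ge0.
rewrite leNgt; apply/negP => lt; move: rk; rewrite leNgt gt0_ltr_powR //.
all: by rewrite nnegrE ?divr_ge0 // ltW.
Qed.

(** A nonempty set lies in the closed ball around any of its points with radius its diameter. Mesh 1
    is chosen to make the diameters finite; empty sets get radius 0. *)
Lemma hausdorff_measure0_coverable d A : 0 < d ->
  hausdorff_measure d A = 0%E -> coverable d A.
Proof.
move=> d0 HA e e0.
have : (hausdorff_content d 1 A < e%:E)%E.
  apply: le_lt_trans (_ : 0 < _)%E; last by rewrite lte_fin.
  by rewrite -HA; apply: ereal_sup_ubound; exists 1 => //=; exact: ltr01.
move=> /ereal_inf_lt[_ [U [AU U1] <-] Ue].
have Ufin k : diameter (U k) \is a fin_num.
  rewrite ge0_fin_numE ?diameter_ge0 //.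
  by rewrite (le_lt_trans (U1 k)) ?ltry.
pose r k := if U k == set0 then 0 else fine (diameter (U k)).
pose y k := if pselect (exists x, U k x) is left h then projT1 (cid h) else 0.
have gaugeE k : hausdorff_gauge d (U k) = (r k `^ d)%:E.
  rewrite /hausdorff_gauge /r; case: ifP => _; first by rewrite powR0 ?gt_eqF.
  by rewrite -poweR_EFin fineK.
exists y, r; split.
- by move=> k; rewrite /r; case: ifP => // _; rewrite fine_ge0 ?diameter_ge0.
- move=> x Ax; have [k _ Ukx] := AU x Ax; exists k => //=.
  have Uy : U k (y k).
    by rewrite /y; case: pselect => [h|[]]; [case: cid | exists x].
  rewrite /r; case: ifPn => [/eqP U0|_]; first by move: Ukx; rewrite U0.
  rewrite -lee_fin fineK // /diameter le_max; apply/orP; right.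
  by apply: ereal_sup_ubound; exists x => //; exists (y k).
- move=> n; rewrite -lee_fin (le_trans _ (ltW Ue)) //.
  rewrite -sumEFin; under eq_bigr do rewrite -gaugeE.
  by apply: nneseries_lim_ge => k _ _; exact: hausdorff_gauge_ge0.
Qed.

Lemma coverable1_lebesgue_measure0 A : coverable 1 A -> lebesgue_measure A = 0%E.
Proof.
move=> cA; pose mu := ((wlength (@idfun R))^*)%mu.
(* By definition this is the outer measure induced by interval length, so monotonicity and countable
   subadditivity hold for arbitrary sets. *)
have -> : lebesgue_measure A = mu A by [].
have w0 : forall I, (0 <= wlength (@idfun R) I)%E by exact: wlength_ge0.
apply/eqP; rewrite eq_le (mu_ext_ge0 w0) andbT.
apply/lee_addgt0Pr => e e0; rewrite add0e.
have e20 : 0 < e / 2 by rewrite divr_gt0.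
have [y [r [r0 Ay re]]] := cA _ e20.
pose U k := [set` `[y k - r k, y k + r k]] : set R.
have AU : A `<=` \bigcup_k U k.
  move=> x /Ay[k _ /=]; rewrite ler_distl => xk; exists k => //.
have muA : (mu A <= mu (\bigcup_k U k))%E by exact: le_mu_ext.
have muU : (mu (\bigcup_k U k) <= \sum_(0 <= k <oo) mu (U k))%E.
  exact: mu_ext_sigma_subadditive.
apply: (le_trans muA); apply: (le_trans muU).
apply: (@le_trans _ _ (\sum_(0 <= k <oo) (2 * r k)%:E)%E).
  apply: lee_nneseries => k _; first by move=> _; exact: mu_ext_ge0.
  have := lebesgue_measure_itv `[y k - r k, y k + r k].
  have -> : lebesgue_measure [set` `[y k - r k, y k + r k]] = mu (U k) by [].
  rewrite /= => ->; case: ifP => _; last by rewrite lee_fin mulr_ge0.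
  by rewrite -EFinB lee_fin; lra.
apply: nneseries_le => [k|n]; first by rewrite mulr_ge0.
rewrite -mulr_sumr; have := re n.
under eq_bigr do rewrite powRr1 //.
lra.
Qed.

End Covers.

(** * Covers of the sets of well approximable numbers *)

Section ApproximableCover.
Context {R : realType}.
Implicit Types (d e b t sigma x a c : R) (p : int) (j k m n q N : nat).

Lemma tail_small (u : nat -> R) b e : (forall k, 0 <= u k) -> 0 < e ->
  (forall n, \sum_(1 <= k < n) u k <= b) ->
  exists2 N, (0 < N)%N & forall n, \sum_(N <= k < n) u k <= e.
Proof.
move=> u0 e0 ub; pose E := range (fun n => \sum_(1 <= k < n) u k).
have supE : has_sup E.
  split; first by exists (\sum_(1 <= k < 0) u k); exists 0%N.
  by exists b => _ [n _ <-].
have [_ [N _ <-] supN] := sup_adherent e0 supE.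
exists N.+1 => // n; have [nN|Nn] := leqP n N.+1.
  by rewrite big_geq // ltW.
have : \sum_(1 <= k < n) u k <= sup E by apply: ub_le_sup; [case: supE | exists n].
have hN : \sum_(1 <= k < N) u k <= \sum_(1 <= k < N.+1) u k.
  case: {supN} N Nn => [|N] _; first by rewrite !big_geq.
  by rewrite [leRHS]big_nat_recr //= lerDl.
rewrite (big_cat_nat (n := N.+1)) ?(ltnW Nn) //=; lra.
Qed.

(** Turns a cover indexed by pairs into a sequence: codes of no pair contribute 0, and finitely many
    codes decode to distinct pairs inside a square. *)
Lemma pickle_inv_sum_le (F : nat * nat -> R) b : (forall i, 0 <= F i) ->
  (forall m n, \sum_(0 <= q < m) \sum_(0 <= j < n) F (q, j) <= b) ->
  forall n, \sum_(0 <= k < n) oapp F 0 (pickle_inv k) <= b.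
Proof.
move=> F0 Fb n; pose u := pmap (@pickle_inv (nat * nat)%type) (iota 0 n).
have -> : \sum_(0 <= k < n) oapp F 0 (pickle_inv k) = \sum_(i <- u) F i.
  rewrite /index_iota subn0 /u; elim: (iota 0 n) => [|k l IHl] /=.
    by rewrite !big_nil.
  rewrite big_cons IHl; case: (pickle_inv k) => [i|] /=; last by rewrite add0r.
  by rewrite big_cons.
have uu : uniq u by rewrite (pmap_uniq (@pickle_invK _)) ?iota_uniq.
pose M := (\max_(i <- u) maxn i.1 i.2).+1.
apply: le_trans (Fb M M).
rewrite -(big_allpairs (F := F)); apply: ler_sum_uniq_sub => // -[q j] iu.
have : (maxn q j < M)%N.
  by rewrite ltnS (@leq_bigmax_seq _ _ predT (fun i => maxn i.1 i.2) (q, j)).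
rewrite gtn_max => /andP[qM jM].
by apply: allpairs_f; rewrite mem_index_iota.
Qed.

Lemma sum_nat_cut_le c l k : 0 <= c ->
  \sum_(0 <= j < l) (if (j <= k)%N then c else 0) <= k.+1%:R * c.
Proof.
move=> c0.
have -> : \sum_(0 <= j < l) (if (j <= k)%N then c else 0) = (minn l k.+1)%:R * c.
  elim: l => [|l IHl]; first by rewrite big_geq // min0n mul0r.
  rewrite big_nat_recr //= IHl; case: leqP => lk.
    have [-> ->] : minn l.+1 k.+1 = l.+1 /\ minn l k.+1 = l by lia.
    by rewrite -natr1; ring.
  have [-> ->] : minn l.+1 k.+1 = k.+1 /\ minn l k.+1 = k.+1 by lia.
  by rewrite addr0.
by rewrite ler_wpM2r // ler_nat geq_minr.
Qed.

Lemma absz_le_shift p (b : nat) : (`|p| <= b)%N ->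
  exists2 j : nat, (j <= b.*2)%N & j%:Z = p + b%:Z.
Proof. by move=> pb; exists `|(p + b%:Z)%R|%N; lia. Qed.

(* Keeping only the fractions with [|p| <= q^(1+eta)] loses no point of the
   limsup set and makes the total d-weight summable over the whole line. *)
Lemma approximable_coverable d sigma : 0 < d -> 0 <= sigma ->
  2 < (1 + sigma) * d -> coverable d (@approximable R sigma).
Proof.
(* Chosen so that (1 + sigma) d = 2 (1 + eta): at most 3 q^(1 + eta) fractions of weight q^(-2 (1 +
   eta)) leave 3 q^-(1 + eta) for each q, which is summable. *)
move=> d0 s0 sd e e0; pose eta := ((1 + sigma) * d - 2) / 2.
have eta0 : 0 < eta by rewrite /eta; lra.
have t1 : 1 < 1 + eta by lra.
have [b b0 bP] := @zeta_bounded R _ t1.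
have e30 : 0 < e / 3 by rewrite divr_gt0.
have [N N0 NP] := tail_small (fun k => powR_ge0 _ _) e30 bP.
pose B q : nat := Num.trunc (q%:R `^ (1 + eta) : R).
have BP q : (B q)%:R <= (q%:R : R) `^ (1 + eta) < (B q).+1%:R.
  by apply: truncn_itv; exact: powR_ge0.
pose I (i : nat * nat) := (N <= i.1)%N && (i.2 <= (B i.1).*2)%N.
(* The second index j codes the numerator p = j - B q, which runs over [-B q, B q]. *)
pose y (i : nat * nat) : R := (i.2%:R - (B i.1)%:R) / i.1%:R.
pose r (i : nat * nat) : R := if I i then i.1%:R `^ (- (1 + sigma)) else 0.
exists (fun k => oapp y 0 (pickle_inv k)), (fun k => oapp r 0 (pickle_inv k)).
have r0 i : 0 <= r i by rewrite /r; case: ifP => // _; exact: powR_ge0.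
split=> [k|x ax|n].
- by case: pickle_inv => [i|] /=.
(* Once q^eta >= |x| + 1, the numerator satisfies |p| <= q |x| + 1 <= q^(1 + eta), so the fraction
   is among those kept. *)
- have [N' N'P] := powR_large (`|x| + 1) eta0.
  have [q [p [Nq qp]]] := ax (maxn N N').
  move: Nq; rewrite geq_max => /andP[Nq /N'P xq].
  have q0 : (0 < q)%N by apply: leq_trans Nq.
  have qR : (0 : R) < q%:R by rewrite ltr0n.
  have q1 : (1 : R) <= q%:R by rewrite ler1n.
  have qs1 : q%:R `^ (- sigma) <= 1 :> R.
    by rewrite -[leRHS](powRr0 q%:R) ler_powR // oppr_le0.
  have pB : `|p%:~R| <= q%:R `^ (1 + eta) :> R.
    rewrite gt0_powRD // powRr1 ?ler0n //.
    have h1 : `|p%:~R| <= q%:R * `|x| + 1 :> R.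
      rewrite -[q%:R in leRHS](gtr0_norm qR) -normrM -lerBlDl.
      by rewrite (le_trans (lerB_dist _ _)) // distrC (le_trans qp).
    have := ler_wpM2l (ltW qR) xq; lra.
  have {}pB : (`|p|%N <= B q)%N.
    have /andP[_ h] := BP q; rewrite -ltnS -(ltr_nat R) (le_lt_trans _ h) //.
    by rewrite natr_absz intr_norm.
  have [j jB jP] := absz_le_shift pB.
  exists (pickle (q, j)) => //=; rewrite pickleK_inv /= /r /I /= Nq /=.
  rewrite jB.
  rewrite /y /= (_ : j%:R - (B q)%:R = p%:~R); last first.
    by rewrite -[p](addrK (B q)%:Z) -jP intrB.
  rewrite opprD gt0_powRD // powR_inv1 ?ler0n // ler_pdivlMl //.
  by rewrite -[X in X * _](gtr0_norm qR) -normrM mulrBr mulrCA mulfV ?mulr1 ?gt_eqF.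
- have oappE (o : option (nat * nat)) :
      (oapp r 0 o) `^ d = oapp (fun i => r i `^ d) 0 o.
    by case: o => //=; rewrite powR0 // gt_eqF.
  under eq_bigr do rewrite oappE.
  apply: pickle_inv_sum_le => [i|m l]; first exact: powR_ge0.
  apply: (@le_trans _ _ (\sum_(N <= q < m) 3 * q%:R `^ (- (1 + eta)))); last first.
    by rewrite -mulr_sumr -ler_pdivlMl // mulrC.
  rewrite [leRHS](big_nat_widenl _ 0) //= [leRHS]big_mkcond /=.
  apply: ler_sum => q _; rewrite /r /I /=; case: (leqP N q) => Nq /=; last first.
    by rewrite big1 // => j _; rewrite powR0 // gt_eqF.
  have qR : (0 : R) < q%:R by rewrite ltr0n (leq_trans _ Nq).
  have q1 : (1 : R) <= q%:R by rewrite ler1n (leq_trans _ Nq).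
  under eq_bigr do rewrite (fun_if (fun z => z `^ d)) powR0 ?gt_eqF //.
  apply: le_trans (sum_nat_cut_le _ _ (powR_ge0 _ _)) _.
  rewrite -powRrM (_ : - (1 + sigma) * d = - (1 + eta) + - (1 + eta)); last first.
    by rewrite /eta; field.
  rewrite gt0_powRD // mulrA ler_wpM2r ?powR_ge0 //.
  rewrite powRN -ler_pdivlMr ?invr_gt0 ?powR_gt0 // invrK.
  have /andP[h _] := BP q.
  have h1 : (1 : R) <= q%:R `^ (1 + eta).
    by rewrite -[leLHS](powRr0 q%:R) ler_powR //; lra.
  by rewrite -natr1 -mul2n natrM; lra.
Qed.

End ApproximableCover.

(** * Counting rationals in an interval *)

Section ManyRationals.
Context {R : realType}.
Implicit Types (a l x y : R) (p : int) (g j m n q Q : nat).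

Definition ints_between x y : seq int :=
  [seq Num.floor x + j%:Z | j <- iota 1 `|Num.floor y - Num.floor x|].

Lemma mem_ints_between x y p : x <= y ->
  (p \in ints_between x y) = (x < p%:~R <= y).
Proof.
move=> xy; have fxy : Num.floor x <= Num.floor y by exact: le_floor.
rewrite -floor_lt_int -floor_ge_int /ints_between.
move: (Num.floor x) (Num.floor y) fxy => u v uv.
apply/mapP/idP => [[j]|/andP[up pv]].
  by rewrite mem_iota => /andP[j0 jv] ->; apply/andP; split; lia.
by exists `|p - u|%N; rewrite ?mem_iota; lia.
Qed.

Lemma size_ints_between x y : x <= y ->
  y - x - 1 <= (size (ints_between x y))%:R <= y - x + 1.
Proof.
move=> xy; have fxy : Num.floor x <= Num.floor y by exact: le_floor.
rewrite size_map size_iota natr_absz ger0_norm ?subr_ge0 // intrB.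
have := floor_itv x; have := floor_itv y; rewrite !intrD.
by move=> /andP[? ?] /andP[? ?]; apply/andP; split; lra.
Qed.

Definition pairs_between a l Q : seq (nat * int) :=
  [seq (q, p) | q <- iota 1 Q, p <- ints_between (q%:R * a) (q%:R * (a + l))].

Lemma mem_pairs_between a l Q q p : 0 <= l ->
  ((q, p) \in pairs_between a l Q) =
  [&& (0 < q)%N, (q <= Q)%N & q%:R * a < p%:~R <= q%:R * (a + l)].
Proof.
move=> l0; have le_q n : n%:R * a <= n%:R * (a + l).
  by rewrite ler_wpM2l ?ler0n // lerDl.
apply/allpairsPdep/idP => [[q' [p' [q'in p'in [-> ->]]]]|].
  move: q'in p'in; rewrite mem_iota mem_ints_between // => ? ->.
  by rewrite andbT; lia.
move=> /and3P[q0 qQ pin]; exists q, p; split => //.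
  by rewrite mem_iota; lia.
by rewrite mem_ints_between.
Qed.

Lemma uniq_pairs_between a l Q : uniq (pairs_between a l Q).
Proof.
apply: allpairs_uniq_dep; first exact: iota_uniq.
  move=> q _; rewrite map_inj_uniq ?iota_uniq // => i j /addrI; lia.
by move=> [q p] [q' p'] _ _ /= [-> ->].
Qed.

(** Each q contributes q l integers up to an error of 1. *)
Lemma size_pairs_between a l Q : 0 <= l ->
  `|(size (pairs_between a l Q))%:R - l * (Q%:R * (Q%:R + 1) / 2)| <= Q%:R.
Proof.
move=> l0; rewrite size_allpairs_dep sumnE big_map natr_sum.
have -> : l * (Q%:R * (Q%:R + 1) / 2) = \sum_(q <- iota 1 Q) (q%:R * l).
  rewrite -mulr_suml mulrC; congr (_ * _).
  elim: Q => [|Q IHQ]; first by rewrite big_nil mul0r mul0r.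
  by rewrite -addn1 iotaD big_cat big_seq1 /= -IHQ add1n -natr1; field.
rewrite -sumrB (le_trans (ler_norm_sum _ _ _)) //.
rewrite -[X in _ <= X%:R](size_iota 1 Q) -sum1_size natr_sum.
apply: ler_sum => q _.
have := @size_ints_between (q%:R * a) (q%:R * (a + l)).
rewrite ler_wpM2l ?ler0n ?lerDl // mulrDr ler_norml => /(_ erefl).
by move=> /andP[? ?]; apply/andP; split; lra.
Qed.

(** Dividing both entries by g keeps the fraction and brings the denominator down to at most Q/g. *)
Lemma count_dvd_pairs a l Q g : 0 <= l -> (0 < g)%N ->
  (count (fun i : nat * int => (g %| i.1) && (g %| `|i.2|)) (pairs_between a l Q)
    <= size (pairs_between a l (Q %/ g)))%N.
Proof.
move=> l0 g0; rewrite -size_filter.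
rewrite -[leqRHS](size_map (fun i : nat * int => ((i.1 * g)%N, i.2 * g%:Z))).
apply: uniq_leq_size; first by rewrite filter_uniq // uniq_pairs_between.
move=> [q p]; rewrite mem_filter /= mem_pairs_between //.
move=> /andP[/andP[/dvdnP[q' ->] gp] /and3P[q0 qQ qap]].
have [p' pE] : exists p', p = p' * g%:Z by apply/dvdzP; rewrite dvdzE.
apply/mapP; exists (q', p') => //=; last by rewrite pE.
have gR : (0 : R) < g%:R by rewrite ltr0n.
rewrite mem_pairs_between // leq_divRL // qQ /=.
move: q0; rewrite muln_gt0 => /andP[-> _] /=; move: qap.
by rewrite pE natrM intrM !(mulrAC _ g%:R) ltr_pM2r // ler_pM2r.
Qed.

(** Telescoping with 1/(u+1)^2 <= 1/u - 1/(u+1) after the first term 1/4 = 3/4 - 1/2. A bound below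
    1 is what makes the sieve leave a positive proportion. *)
Lemma sum_inv_sqr n : \sum_(2 <= g < n) (g%:R ^+ 2)^-1 <= 3 / 4 :> R.
Proof.
have H m : \sum_(2 <= g < m.+3) (g%:R ^+ 2)^-1 <= 3 / 4 - m.+2%:R^-1 :> R; last first.
  have [n3|n3] := ltnP n 3; first by rewrite big_geq ?divr_ge0.
  by rewrite -(subnK n3) addn3; apply: le_trans (H _) _; rewrite gerBl invr_ge0.
elim: m => [|m IHm]; first by rewrite big_nat1; lra.
rewrite big_nat_recr //=; set u : R := m.+2%:R.
have u0 : 0 < u by rewrite ltr0n.
have -> : m.+3%:R = u + 1 :> R by rewrite natr1.
have : ((u + 1) ^+ 2)^-1 <= u^-1 - (u + 1)^-1.
  have -> : u^-1 - (u + 1)^-1 = (u * (u + 1))^-1 by field; lra.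
  have u1 : 0 < u + 1 by lra.
  rewrite lef_pV2 ?posrE ?exprn_gt0 ?mulr_gt0 //.
  by rewrite expr2 ler_wpM2r ?(ltW u1) // lerDl.
by move=> h; rewrite (le_trans (lerD IHm h)) // addrA subrK.
Qed.

Lemma harmonic_le_sqrt n : \sum_(1 <= g < n.+1) g%:R^-1 <= 2 * Num.sqrt n%:R :> R.
Proof.
elim: n => [|n IHn]; first by rewrite big_geq // mulr_ge0 // sqrtr_ge0.
rewrite big_nat_recr //=; set u := Num.sqrt n%:R in IHn *.
set v := Num.sqrt n.+1%:R.
have u2 : u ^+ 2 = n%:R by rewrite sqr_sqrtr.
have v2 : v ^+ 2 = n.+1%:R by rewrite sqr_sqrtr.
have v1 : 1 <= v by rewrite -[1]sqrtr1 ler_wsqrtr // ler1n.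
have u0 : 0 <= u by exact: sqrtr_ge0.
have uv : u <= v by rewrite ler_wsqrtr // ler_nat.
have uv1 : v ^+ 2 - u ^+ 2 = 1 by rewrite u2 v2 -natr1; ring.
rewrite -v2; suff : (v ^+ 2)^-1 <= 2 * (v - u) by lra.
have v0 : 0 < v by lra.
rewrite -[leLHS]mul1r ler_pdivrMr ?exprn_gt0 //.
have vu : v + u <= 2 * v ^+ 2 by nra.
have vu0 : 0 <= v - u by lra.
have := ler_wpM2l vu0 vu; rewrite -subr_sqr uv1; lra.
Qed.

(** Union bound: a pair that is not coprime is counted at least for g its gcd, which lies between 2
    and Q. *)
Lemma count_not_coprime_pairs a l Q : 0 <= l ->
  (count (fun i : nat * int => ~~ coprime i.1 `|i.2|) (pairs_between a l Q)
    <= \sum_(2 <= g < Q.+1) size (pairs_between a l (Q %/ g)))%N.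
Proof.
move=> l0; apply: (@leq_trans (\sum_(2 <= g < Q.+1) count (fun i : nat * int =>
    (g %| i.1) && (g %| `|i.2|)) (pairs_between a l Q))%N); last first.
  rewrite big_seq [leqRHS]big_seq; apply: leq_sum => g.
  rewrite mem_index_iota => /andP[g2 _]; apply: count_dvd_pairs => //.
  exact: ltnW.
under eq_bigr do rewrite -sum1_count big_mkcond.
rewrite exchange_big /= -sum1_count big_mkcond big_seq [leqRHS]big_seq.
apply: leq_sum => -[q p]; rewrite mem_pairs_between //= => /and3P[q0 qQ _].
case: ifP => // ncop; pose g := gcdn q `|p|.
have g2 : (2 <= g)%N.
  have : (0 < g)%N by rewrite gcdn_gt0 q0.
  by move: ncop; rewrite /coprime -/g; case: g => [|[|]].
rewrite (bigD1_seq g) ?iota_uniq //=; first by rewrite dvdn_gcdl dvdn_gcdr.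
by rewrite mem_index_iota g2 ltnS (leq_trans _ qQ) // dvdn_leq // dvdn_gcdl.
Qed.

(* The sieve leaves at least [1 - sum_(g >= 2) g^-2 >= 1/4] of the about
   [l Q^2 / 2] pairs, up to an error of order [Q sqrt Q]. *)
Lemma count_coprime_pairs a l : 0 < l -> exists Q0, forall Q, (Q0 <= Q)%N ->
  l * Q%:R ^+ 2 / 16 <=
  (count (fun i : nat * int => coprime i.1 `|i.2|) (pairs_between a l Q))%:R.
Proof.
(* This threshold gives sqrt Q >= 16 (l + 3)/l, so the errors, at most (l + 3) Q sqrt Q, cost at
   most half of the main term l Q^2 (1/2 - 3/8). *)
move=> l0; exists (Num.trunc ((16 * (l + 3) / l) ^+ 2)).+1 => Q Q0Q.
have Q0 : (0 < Q)%N by apply: leq_trans Q0Q.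
have QR : (0 : R) < Q%:R by rewrite ltr0n.
set w := Num.sqrt (Q%:R : R).
have w2 : w ^+ 2 = Q%:R by rewrite sqr_sqrtr.
have wl : 16 * (l + 3) <= l * w.
  have x0 : 0 <= 16 * (l + 3) / l by rewrite divr_ge0 ?mulr_ge0 ?addr_ge0 ?(ltW l0).
  rewrite [leRHS]mulrC -ler_pdivrMr // -[leLHS](ger0_norm x0).
  rewrite -sqrtr_sqr ler_wsqrtr // (le_trans (ltW (truncnS_gt _))) //.
  by rewrite ler_nat.
have w1 : 1 <= w by rewrite -[1]sqrtr1 ler_wsqrtr // ler1n.
pose C := \sum_(2 <= g < Q.+1) (size (pairs_between a l (Q %/ g)))%:R : R.
have CP : C <= l * Q%:R ^+ 2 / 2 * (3 / 4) + (l / 2 + 1) * Q%:R * (2 * w).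
  apply: (@le_trans _ _ (\sum_(2 <= g < Q.+1)
     (l * Q%:R ^+ 2 / 2 * (g%:R ^+ 2)^-1 + (l / 2 + 1) * Q%:R * g%:R^-1))).
    rewrite /C big_seq [leRHS]big_seq; apply: ler_sum => g.
    rewrite mem_index_iota => /andP[g2 _].
    have g0 : (0 : R) < g%:R by rewrite ltr0n (leq_trans _ g2).
    have := size_pairs_between a (Q %/ g) (ltW l0).
    set S : R := (size _)%:R; set m : R := (Q %/ g)%:R.
    rewrite ler_norml => /andP[_ SP].
    have m0 : 0 <= m by rewrite ler0n.
    have mg : m <= Q%:R * g%:R^-1.
      by rewrite ler_pdivlMr // -natrM ler_nat leq_trunc_div.
    set v := Q%:R * g%:R^-1 in mg.
    have -> : l * Q%:R ^+ 2 / 2 * (g%:R ^+ 2)^-1 + (l / 2 + 1) * Q%:R * g%:R^-1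
       = l * (v * (v + 1) / 2) + v by rewrite /v; field; rewrite gt_eqF.
    have mv : m * (m + 1) <= v * (v + 1) by nra.
    have := ler_wpM2l (ltW l0) mv; lra.
  rewrite big_split /= -!mulr_sumr lerD // ler_wpM2l ?mulr_ge0 ?exprn_ge0 //.
  - exact: ltW.
  - exact: sum_inv_sqr.
  - lra.
  - apply: le_trans (harmonic_le_sqrt Q).
    by rewrite [leRHS]big_ltn // lerDr invr_ge0.
have := count_not_coprime_pairs a Q (ltW l0).
rewrite -(ler_nat R) natr_sum -/C => bad.
have := size_pairs_between a Q (ltW l0).
rewrite -(count_predC (fun i : nat * int => coprime i.1 `|i.2|)) natrD.
move: bad; rewrite /predC /=.
set G : R := (count (fun i : nat * int => coprime i.1 `|i.2|) _)%:R.
set B : R := (count _ _)%:R => bad; rewrite ler_norml => /andP[tot _].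
have h : (l + 3) * w * Q%:R <= l * Q%:R ^+ 2 / 16.
  have wQ : 0 <= w * Q%:R by rewrite mulr_ge0 // sqrtr_ge0.
  have := ler_wpM2r wQ wl.
  have -> : l * w * (w * Q%:R) = l * w ^+ 2 * Q%:R by ring.
  rewrite w2.
  lra.
have hw : Q%:R <= w * Q%:R by rewrite ler_peMl // ltW.
have lQ : 0 <= l * Q%:R by rewrite mulr_ge0 // ltW.
lra.
Qed.

End ManyRationals.

(** * Choosing a child interval that avoids the given intervals *)

Section Avoidance.
Context {R : realType}.
Implicit Types (a b c d l x z tau theta delta : R) (p : int) (i j m n q Q : nat).

(** Distinct fractions p/q and p'/q' differ by at least 1/(q q') >= Q^-2; restricting to coprime
    pairs makes the map from pairs to fractions injective. *)
Lemma separated_fractions a l : 0 < l -> exists Q0, forall Q, (Q0 <= Q)%N ->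
  exists zs : seq R, [/\ uniq zs, separated (Q%:R ^+ 2)^-1 zs,
    l * Q%:R ^+ 2 / 16 <= (size zs)%:R & forall z, z \in zs ->
    a < z <= a + l /\ exists q p, (0 < q <= Q)%N /\ z = p%:~R / q%:R].
Proof.
move=> l0; have [Q0 Q0P] := @count_coprime_pairs R a l l0.
exists Q0 => Q QQ; pose s := [seq i <- pairs_between a l Q | coprime i.1 `|i.2|].
pose f (i : nat * int) : R := i.2%:~R / i.1%:R.
have sP (i : nat * int) : i \in s -> [/\ (0 < i.1 <= Q)%N, (0 : R) < i.1%:R,
    i.1%:R * a < i.2%:~R <= i.1%:R * (a + l) & coprime i.1 `|i.2|].
  case: i => q p; rewrite mem_filter mem_pairs_between ?(ltW l0) //=.
  by move=> /andP[cop /and3P[q0 qQ qp]]; rewrite ltr0n q0 qQ.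
have cross (i j : nat * int) : i \in s -> j \in s ->
    f i - f j = (i.2 * j.1%:Z - j.2 * i.1%:Z)%:~R / (i.1%:R * j.1%:R).
  move=> /sP[_ i0 _ _] /sP[_ j0 _ _]; rewrite /f intrB !intrM.
  by field; rewrite !gt_eqF.
have finj : {in s &, injective f}.
  move=> i j iin jin fij; have := cross i j iin jin.
  have [/andP[i1 _] i0 _ icop] := sP _ iin; have [/andP[j1 _] j0 _ jcop] := sP _ jin.
  rewrite fij subrr => /esym/eqP.
  rewrite mulf_eq0 invr_eq0 mulf_eq0 (gt_eqF i0) (gt_eqF j0) !orbF intr_eq0.
  rewrite subr_eq0 => /eqP e.
  have ea : (`|i.2| * j.1 = `|j.2| * i.1)%N by have := congr1 absz e; rewrite !abszM.
  have ij : i.1 = j.1.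
    apply/eqP; rewrite eqn_dvd; apply/andP; split.
      by rewrite -(Gauss_dvdr _ icop) ea dvdn_mull.
    by rewrite -(Gauss_dvdr _ jcop) -ea dvdn_mull.
  move: e; rewrite ij => /mulIf; have j1' : j.1%:Z != 0 by case: (j.1) j1.
  move=> /(_ j1'); move: ij; clear.
  by case: i j => [q p] [q' p'] /= -> ->.
exists (map f s); split.
- by rewrite map_inj_in_uniq ?filter_uniq ?uniq_pairs_between.
- move=> _ _ /mapP[i iin ->] /mapP[j jin ->] fij.
  have := cross i j iin jin; set e : int := i.2 * _ - _ => fE.
  have [/andP[i1 iQ] i0 _ _] := sP _ iin; have [/andP[j1 jQ] j0 _ _] := sP _ jin.
  have e1 : (1 : R) <= `|e%:~R|.
    rewrite -intr_norm ler1z; move: fij; rewrite -subr_eq0 fE mulf_eq0 intr_eq0.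
    by rewrite negb_or => /andP[e0 _]; lia.
  rewrite fE normrM normfV normrM (gtr0_norm i0) (gtr0_norm j0).
  rewrite -[leLHS]mul1r ler_pM ?invr_ge0 ?exprn_ge0 //.
  by rewrite lef_pV2 ?posrE ?mulr_gt0 ?exprn_gt0 ?ler_pM ?ler_nat ?(ltW i0) ?(ltW j0) //
     ltr0n (leq_trans i1).
- by rewrite size_map size_filter Q0P.
- move=> _ /mapP[i /sP[iQ i0 /andP[ia il] _] ->]; split; last by exists i.1, i.2.
  by rewrite /f ltr_pdivlMr // ler_pdivrMr // mulrC ia mulrC.
Qed.

Lemma count_separated_le delta (zs : seq R) x b : 0 < delta -> 0 <= b ->
  uniq zs -> separated delta zs ->
  (count (fun z => `|z - x| <= b) zs)%:R <= 2 * b / delta + 1.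
Proof.
move=> d0 b0 uzs sep; rewrite -size_filter; set ws := [seq _ <- _ | _].
have wsP w : w \in ws -> w \in zs /\ `|w - x| <= b.
  by rewrite mem_filter => /andP[].
have inj := separated_trunc_inj (ys := ws) (b := x - b) d0.
have {}inj : {in ws &, injective (fun z => Num.trunc ((z - (x - b)) / delta))}.
  apply: inj => [u v /wsP[uin _] /wsP[vin _]|u /wsP[_]]; first exact: sep.
  by rewrite ler_norml; lra.
have b20 : 0 <= 2 * b / delta by rewrite divr_ge0 ?mulr_ge0 // ltW.
apply: (@le_trans _ _ ((Num.trunc (2 * b / delta)).+1)%:R); last first.
  by rewrite -natr1 lerD2r; case/andP: (truncn_itv b20).
rewrite ler_nat -(size_map (fun z => Num.trunc ((z - (x - b)) / delta))).
rewrite -[leqRHS](size_iota 0); apply: uniq_leq_size.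
  by rewrite map_inj_in_uniq // filter_uniq.
move=> _ /mapP[z /wsP[_ zb] ->]; rewrite mem_iota /= ltnS.
apply: le_truncn; rewrite ler_wpM2r ?invr_ge0 ?(ltW d0) //.
by move: zb; rewrite ler_norml; lra.
Qed.

Variables (y r : nat -> R) (c : R).

Definition meets a l i := (y i - r i <= a + l) && (a <= y i + r i).

(* The cap 2 exceeds the bound 1 in [avoiding]: an interval i meeting [a, a+l]
   has weight less than 2, hence is short compared with l. *)
Definition weight d l i := Num.min ((c * r i / l) `^ d) 2.

Definition avoiding d a l :=
  forall n, \sum_(0 <= i < n | meets a l i) weight d l i <= 1.

Hypotheses (r_gt0 : forall i, 0 < r i) (c_ge : 10 * 64 <= c).

Let c_gt0 : 0 < c. Proof. by apply: lt_le_trans c_ge; rewrite mulr_gt0. Qed.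

Lemma weight_ge0 d l i : 0 <= weight d l i.
Proof. by rewrite /weight le_min powR_ge0 /=. Qed.

Lemma avoiding_weight d a l i : 0 < d -> 0 < l -> avoiding d a l -> meets a l i ->
  c * r i / l <= 1 /\ weight d l i = (c * r i / l) `^ d.
Proof.
move=> d0 l0 av mi; have := av i.+1; rewrite big_mkcond big_nat_recr //= mi.
have s0 : 0 <= \sum_(0 <= j < i) (if meets a l j then weight d l j else 0).
  by rewrite sumr_ge0 // => j _; case: ifP => // _; exact: weight_ge0.
move=> s1; have {s0 s1} : weight d l i <= 1 by lra.
rewrite /weight ge_min (_ : (2 <= 1 :> R) = false) ?orbF; last first.
  by apply/negbTE; rewrite -ltNge ltr1n.
set u := c * r i / l => u1; split.
  rewrite leNgt; apply/negP => lt; move: u1; rewrite leNgt => /negP; apply.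
  have p1 : 1 `^ d = 1 :> R by rewrite powR1.
  by rewrite -[ltLHS]p1 gt0_ltr_powR ?nnegrE //; lra.
by apply/min_idPl; rewrite (le_trans u1) // ler1n.
Qed.

(* An interval of radius [r i] meets at most [5 max(1, r i Q^2)] children. If
   [r i Q^2 <= 1], the loss [(2 l Q^tau)^d] in the weight is beaten by [l Q^2]
   because [d tau < 2]; otherwise the cap 2 on the weight suffices, as
   [u <= u^d] for [u = c r i / l <= 1]. *)
Lemma child_count_le d tau l Q (zs : seq R) a i : 2 <= tau -> 0 < d < 1 ->
  0 < l -> (0 < Q)%N -> 5 * (2 * l * Q%:R `^ tau) `^ d <= l * Q%:R ^+ 2 / 64 ->
  uniq zs -> separated (Q%:R ^+ 2)^-1 zs -> avoiding d a l -> meets a l i ->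
  (count (fun z => meets (z + Q%:R `^ (- tau) / 2) (Q%:R `^ (- tau) / 2) i) zs)%:R
    * weight d (Q%:R `^ (- tau) / 2) i <= l * Q%:R ^+ 2 / 64 * weight d l i.
Proof.
move=> tau2 /andP[d0 d1] l0 Q0 hQ uzs sep av mi.
have QR : (0 : R) < Q%:R by rewrite ltr0n.
have [u1 ->] := avoiding_weight d0 l0 av mi.
set u := c * r i / l in u1 *; set K := l * Q%:R ^+ 2 / 64 in hQ *.
have u0 : 0 < u by rewrite divr_gt0 ?mulr_gt0.
have ul : 10 * 64 * r i <= u * l.
  by rewrite /u divfK ?gt_eqF // ler_wpM2r // ltW.
have Q20 : (0 : R) < Q%:R ^+ 2 by rewrite exprn_gt0.
set theta := Q%:R `^ (- tau).
have th0 : 0 < theta by rewrite powR_gt0.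
have thQ : theta * Q%:R ^+ 2 <= 1.
  rewrite /theta powRN ler_pdivrMl ?powR_gt0 // mulr1 -powR_mulrn ?ler0n //.
  by rewrite ler_powR ?ler1n.
(* Meeting [z + theta/2, z + theta] forces |z - y_i| <= r_i + theta, and theta Q^2 <= 1 because tau
   >= 2; hence 2 (r_i + theta) Q^2 + 1 is at most the bound stated. *)
have cnt : (count (fun z => meets (z + theta / 2) (theta / 2) i) zs)%:R <=
    2 * (r i * Q%:R ^+ 2) + 3.
  have b0 : 0 <= r i + theta by rewrite addr_ge0 // ltW.
  have dl : 0 < (Q%:R ^+ 2)^-1 :> R by rewrite invr_gt0.
  have := count_separated_le (y i) dl b0 uzs sep.
  rewrite invrK mulrDr mulrDl => h.
  have sub : (count (fun z => meets (z + theta / 2) (theta / 2) i) zs <=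
      count (fun z => (`|z - y i| <= r i + theta)%R) zs)%N.
    apply: sub_count => z /= /andP[h1 h2]; rewrite ler_norml.
    by apply/andP; split; lra.
  move: sub; rewrite -(ler_nat R); lra.
have [rQ|rQ] := leP (r i * Q%:R ^+ 2) 1.
(* Replacing the length l by theta/2 multiplies c r_i / l by 2 l Q^tau. *)
- have -> : K * u `^ d = u `^ d * K by rewrite mulrC.
  apply: le_trans (_ : 5 * (u `^ d * (2 * l * Q%:R `^ tau) `^ d) <= _); last first.
    by rewrite mulrCA ler_wpM2l ?powR_ge0.
  rewrite ler_pM ?ler0n ?weight_ge0 //; first lra.
  rewrite /weight ge_min -powRM ?(ltW u0) ?mulr_ge0 ?powR_ge0 ?(ltW l0) //.
  apply/orP; left; rewrite le_eqVlt; apply/orP; left; apply/eqP; congr (_ `^ _).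
  by rewrite /u /theta powRN; field; rewrite !gt_eqF // powR_gt0.
(* Count times cap is at most 10 r_i Q^2, and c >= 10 * 64 makes this at most K u: the origin of the
   constant. *)
- apply: le_trans (_ : 5 * (r i * Q%:R ^+ 2) * 2 <= _).
    by rewrite ler_pM ?ler0n ?weight_ge0 ?ge_min ?lexx ?orbT //; lra.
  have uud : u <= u `^ d by rewrite ger1_powR ?(ltW d1) // u0.
  apply: le_trans (_ : K * u <= _); last first.
    by rewrite ler_wpM2l // /K divr_ge0 ?mulr_ge0 ?(ltW l0) ?(ltW Q20).
  have -> : K * u = u * l * Q%:R ^+ 2 / 64 by rewrite /K; ring.
  rewrite ler_pdivlMr // (_ : _ * 64 = 10 * 64 * r i * Q%:R ^+ 2); last by ring.
  by rewrite ler_wpM2r // ltW.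
Qed.

(* Averaged over all children, the total weight is at most 1/2. *)
Lemma avoiding_child d tau a l : 2 <= tau -> 0 < d -> d * tau < 2 -> 0 < l ->
  avoiding d a l -> exists Q0, forall Q, (Q0 <= Q)%N -> exists q p,
  [/\ (0 < q <= Q)%N, a <= p%:~R / q%:R,
      p%:~R / q%:R + Q%:R `^ (- tau) <= a + l
    & avoiding d (p%:~R / q%:R + Q%:R `^ (- tau) / 2) (Q%:R `^ (- tau) / 2)].
Proof.
move=> tau2 d0 dtau l0 av; have l20 : 0 < l / 2 by rewrite divr_gt0.
have d1 : d < 1 by nra.
(* Fractions z are taken in the left half only, so that z + theta with theta <= l/2 stays inside the
   parent. *)
have [Q1 Q1P] := separated_fractions a l20.
have tau0 : 0 < tau by lra.
have [Q2 Q2P] := powR_large (l / 2)^-1 tau0.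
have e0 : 0 < 2 - d * tau by lra.
(* As 2 - d tau > 0, l Q^2 / 64 eventually exceeds 5 (2 l Q^tau)^d, as [child_count_le] demands. *)
have [Q3 Q3P] := powR_large (5 * 64 * (2 * l) `^ d / l) e0.
exists (maxn (maxn Q1 Q2) (maxn Q3 1)) => Q.
rewrite !geq_max => /andP[/andP[/Q1P[zs [uzs sep szs zsP]] /Q2P hQ2] /andP[/Q3P hQ3 Q0]].
have QR : (0 : R) < Q%:R by rewrite ltr0n.
have th : Q%:R `^ (- tau) <= l / 2.
  by rewrite powRN -[leRHS]invrK lef_pV2 ?posrE ?invr_gt0 ?powR_gt0.
have hQ : 5 * (2 * l * Q%:R `^ tau) `^ d <= l * Q%:R ^+ 2 / 64.
  have -> : Q%:R ^+ 2 = Q%:R `^ (2 - d * tau) * Q%:R `^ (d * tau) :> R.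
    by rewrite -gt0_powRD // subrK powR_mulrn ?ler0n.
  rewrite powRM ?mulr_ge0 ?powR_ge0 ?(ltW l0) // -powRrM [tau * d]mulrC.
  move: hQ3; rewrite ler_pdivrMr // => /(ler_wpM2r (powR_ge0 Q%:R (d * tau))).
  lra.
apply: contrapT => nex; set theta := Q%:R `^ (- tau) in nex th.
have th0 : 0 < theta by rewrite powR_gt0.
(* Were no child admissible, each would exceed weight 1 at a finite stage. Membership stands under
   the quantifier so that [choice] gives a function on all reals. *)
have bad z : exists n, z \in zs ->
    1 < \sum_(0 <= i < n | meets (z + theta / 2) (theta / 2) i) weight d (theta / 2) i.
  apply: contrapT => /forallNP nbad.
  have zin : z \in zs by apply: contrapT => zout; apply: (nbad 0%N) => /zout.
  have [/andP[az zl] [q [p [qQ zE]]]] := zsP z zin.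
  apply: nex; exists q, p; rewrite -zE; split => //; [exact: ltW | lra |].
  move=> n; rewrite leNgt; apply/negP => lt; exact: (nbad n).
have {bad} [nz nzP] := choice bad.
pose N := \max_(z <- zs) nz z.
pose K : R := l * Q%:R ^+ 2 / 64.
have K0 : 0 < K by rewrite /K divr_gt0 ?mulr_gt0 ?exprn_gt0.
have large : (size zs)%:R <= \sum_(z <- zs)
    \sum_(0 <= i < N | meets (z + theta / 2) (theta / 2) i) weight d (theta / 2) i.
  rewrite -sum1_size natr_sum big_seq [leRHS]big_seq; apply: ler_sum => z zin.
  have zN : (nz z <= N)%N by exact: (@leq_bigmax_seq _ _ predT nz).
  apply: le_trans (ltW (nzP z zin)) _.
  rewrite [leRHS](big_cat_nat (n := nz z)) //= lerDl.
  by rewrite sumr_ge0 // => i _; exact: weight_ge0.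
(* Summed interval by interval, the total is at most K; an interval missing the parent misses all
   children. *)
have : \sum_(z <- zs) \sum_(0 <= i < N | meets (z + theta / 2) (theta / 2) i)
    weight d (theta / 2) i <= K * 1.
  apply: le_trans (ler_wpM2l (ltW K0) (av N)).
  under eq_bigr do rewrite big_mkcond /=.
  rewrite exchange_big /= mulr_sumr [leRHS]big_mkcond; apply: ler_sum => i _.
  rewrite -big_mkcond /= big_const_seq iter_addr_0 -[leLHS]mulr_natl.
  case: ifPn => mi.
    by apply: (child_count_le tau2 _ l0 Q0 hQ uzs sep av mi); rewrite d0.
  rewrite (_ : count _ zs = 0%N) ?mul0r //; apply/eqP; rewrite -leqn0 leqNgt -has_count.
  apply/hasPn => z zin; apply: contra mi => /andP[h1 h2].
  have [/andP[az zl] _] := zsP z zin.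
  by apply/andP; split; lra.
(* There are at least (l/2) Q^2 / 16 = 2 K children, each of weight above 1, against a total of at
   most K. *)
rewrite mulr1 => small; have := le_trans szs (le_trans large small).
rewrite /K in K0 *; lra.
Qed.

End Avoidance.

(** * The lower bound for the dimension *)

Section LowerBound.
Context {R : realType}.
Implicit Types (a b c d e l x z tau s t sigma : R) (p : int) (i j k m n q N Q : nat).

Lemma natV_small c : 0 < c -> exists2 N, (0 < N)%N & forall Q, (N <= Q)%N -> Q%:R^-1 < c.
Proof.
move=> c0; exists (Num.trunc c^-1).+1 => // Q NQ.
have h : c^-1 < Q%:R by rewrite (lt_le_trans (truncnS_gt _)) // ler_nat.
by rewrite -[ltRHS]invrK ltf_pV2 ?posrE ?invr_gt0 // (lt_trans _ h) ?invr_gt0.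
Qed.

Lemma powRN_tau_le tau Q : 2 <= tau -> (0 < Q)%N ->
  Q%:R * Q%:R `^ (- tau) <= Q%:R^-1 :> R.
Proof.
move=> tau2 Q0; have QR : (0 : R) < Q%:R by rewrite ltr0n.
rewrite -[in leRHS]powR_inv1 ?ler0n // -[X in X * _]powRr1 ?ler0n // -gt0_powRD //.
by rewrite ler_powR ?ler1n //; lra.
Qed.

(* The lower bound on [x - p/q] is what makes x irrational. *)
Definition close_above tau x := forall K, exists Q q p,
  [/\ (K <= Q)%N, (0 < q <= Q)%N
    & Q%:R `^ (- tau) / 2 <= x - p%:~R / q%:R <= Q%:R `^ (- tau)].

Lemma close_above_mul tau x Q q p : (0 < q <= Q)%N ->
  Q%:R `^ (- tau) / 2 <= x - p%:~R / q%:R <= Q%:R `^ (- tau) ->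
  0 < q%:R * x - p%:~R <= q%:R * Q%:R `^ (- tau).
Proof.
move=> /andP[q0 qQ] /andP[h1 h2]; have qR : (0 : R) < q%:R by rewrite ltr0n.
have -> : q%:R * x - p%:~R = q%:R * (x - p%:~R / q%:R) by field; rewrite gt_eqF.
rewrite ler_wpM2l ?(ltW qR) // andbT mulr_gt0 // (lt_le_trans _ h1) //.
by rewrite divr_gt0 // powR_gt0 // ltr0n (leq_trans q0).
Qed.

(** If x = v/B, then B (q x - p) is a positive integer, yet q x - p <= Q^(1 - tau) <= 1/Q < 1/B for
    Q large. *)
Lemma close_above_irrational tau x : 2 <= tau -> close_above tau x -> irrational x.
Proof.
move=> tau2 cx /rationalP[u [b xE]].
have [v [B [B0 {}xE]]] : exists v B, (0 < B)%N /\ x = v%:~R / B%:R.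
  (* A zero denominator stands for x = 0 and is replaced by 0/1. *)
  case: b xE => [|b] ->; last by exists u, b.+1.
  by exists 0, 1%N; rewrite invr0 mulr0 mul0r.
have BR : (0 : R) < B%:R by rewrite ltr0n.
have BV : (0 : R) < B%:R^-1 by rewrite invr_gt0.
have [N N0 NP] := natV_small BV.
have [Q [q [p [NQ qQ /close_above_mul]]]] := cx N.
move=> /(_ qQ) /andP[h1 h2]; case/andP: qQ => q0 qQ.
have intE : B%:R * (q%:R * x - p%:~R) = (q%:Z * v - p * B%:Z)%:~R.
  by rewrite xE intrB !intrM; field; rewrite gt_eqF.
have : 0 < B%:R * (q%:R * x - p%:~R) by rewrite mulr_gt0.
rewrite intE ltr0z gtz0_ge1 -(ler1z R) -intE leNgt => /negP; apply.
rewrite mulrC -ltr_pdivlMr // mul1r; apply: le_lt_trans (NP Q NQ).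
apply: le_trans (powRN_tau_le tau2 (leq_trans q0 qQ)); apply: le_trans h2 _.
by rewrite ler_wpM2r ?powR_ge0 ?ler_nat.
Qed.

(** Since q <= Q, the error is at most q^(1 - tau). A large Q alone does not make q large;
    [irrational_gap] does, the error being below any given constant. *)
Lemma close_above_approximable tau x : 2 <= tau -> close_above tau x ->
  approximable (tau - 1) x.
Proof.
move=> tau2 cx N; have irrx := close_above_irrational tau2 cx.
have [c c0 cP] := irrational_gap N irrx; have [M M0 MP] := natV_small c0.
have [Q [q [p [MQ qQ /close_above_mul]]]] := cx M.
move=> /(_ qQ) /andP[h1 h2]; case/andP: qQ => q0 qQ.
have qR : (0 : R) < q%:R by rewrite ltr0n.
exists q, p; rewrite gtr0_norm //; split.
  rewrite leqNgt; apply/negP => /ltnW qN.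
  have := cP q p; rewrite q0 qN gtr0_norm // => /(_ erefl).
  rewrite leNgt => /negP; apply; apply: le_lt_trans (MP Q MQ).
  apply: le_trans (powRN_tau_le tau2 (leq_trans q0 qQ)); apply: le_trans h2 _.
  by rewrite ler_wpM2r ?powR_ge0 ?ler_nat.
apply: le_trans h2 _; rewrite opprB gt0_powRD // powRr1 ?ler0n //.
by rewrite ler_wpM2l ?ler0n // powRN_le ?ler_nat //; lra.
Qed.

(** Iterates [avoiding_child]. If the common point lay in interval i, that interval would meet every
    stage, so c r_i would be at most the length of each stage, and these lengths become arbitrarily
    small. *)
Lemma nested_avoiding (y r : nat -> R) c d tau a l : 
  (forall i, 0 < r i) -> 10 * 64 <= c ->
  2 <= tau -> 0 < d -> d * tau < 2 -> 0 < l -> avoiding y r c d a l ->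
  exists x, [/\ close_above tau x, a <= x <= a + l & forall i, r i < `|x - y i|].
Proof.
move=> r0 c640 tau2 d0 dtau l0 av.
have c0 : 0 < c by lra.
pose good (I : R * R) := 0 < I.2 /\ avoiding y r c d I.1 I.2.
pose child (k : nat) (I J : R * R) Q q p :=
  [/\ (k < Q)%N, (0 < q <= Q)%N, I.1 <= p%:~R / q%:R,
    p%:~R / q%:R + Q%:R `^ (- tau) <= I.1 + I.2
  & J = (p%:~R / q%:R + Q%:R `^ (- tau) / 2, Q%:R `^ (- tau) / 2)].
(* The state carries the stage number, so that stage k can demand Q > k. *)
pose S := {u : nat * (R * R) | good u.2}.
pose next (u v : S) := (sval v).1 = (sval u).1.+1 /\
  exists Q q p, child (sval u).1 (sval u).2 (sval v).2 Q q p.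
have step (u : S) : {v : S | next u v}.
  apply: cid; case: u => -[k [a' l']] [/= l'0 av'].
  have [Q0 Q0P] := avoiding_child r0 c640 tau2 d0 dtau l'0 av'.
  pose Q := maxn Q0 k.+1; have kQ : (k < Q)%N by rewrite leq_max ltnSn orbT.
  have [q [p [qQ aq ql avq]]] := Q0P Q (leq_maxl _ _).
  have g : good (p%:~R / q%:R + Q%:R `^ (- tau) / 2, Q%:R `^ (- tau) / 2).
    split => //=; rewrite divr_gt0 // powR_gt0 // ltr0n.
    by rewrite (leq_trans _ kQ).
  by exists (exist _ (k.+1, _) g); split => //=; exists Q, q, p.
have g0 : good (a, l) by [].
have [f [f0 fS]] := dependent_choice step (exist _ (0%N, (a, l)) g0).
pose A k := (sval (f k)).2.1; pose L k := (sval (f k)).2.2.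
have A0 : A 0%N = a by rewrite /A f0.
have L0 : L 0%N = l by rewrite /L f0.
have fk k : (sval (f k)).1 = k.
  by elim: k => [|k IHk]; [rewrite f0 | rewrite (fS k).1 IHk].
have AL k : exists Q q p, [/\ (k < Q)%N, (0 < q <= Q)%N,
    A k <= p%:~R / q%:R, p%:~R / q%:R + Q%:R `^ (- tau) <= A k + L k
    & A k.+1 = p%:~R / q%:R + Q%:R `^ (- tau) / 2 /\ L k.+1 = Q%:R `^ (- tau) / 2].
  have [_ [Q [q [p]]]] := fS k; rewrite fk => -[kQ qQ h1 h2 h3].
  by exists Q, q, p; split => //; rewrite /A /L h3.
have Lgt k : 0 < L k by have [] := proj2_sig (f k).
have Av k : avoiding y r c d (A k) (L k) by have [] := proj2_sig (f k).
have Amono : {homo A : m n / (m <= n)%N >-> m <= n}.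
  apply: homo_leq => [u|u v w|k]; [exact: lexx | exact: le_trans |].
  have [Q [q [p [_ _ h1 _ [-> _]]]]] := AL k; apply: (le_trans h1).
  by rewrite lerDl divr_ge0 ?powR_ge0.
have ALmono : {homo (fun k => A k + L k) : m n / (m <= n)%N >-> n <= m}.
  apply: homo_leq => [u|u v w h1 h2|k]; [exact: lexx | exact: le_trans h1 |].
  have [Q [q [p [_ _ _ h1 [-> ->]]]]] := AL k.
  by rewrite -addrA -splitr.
have AleAL m n : A m <= A n + L n.
  apply: (@le_trans _ _ (A (maxn m n))); first by rewrite Amono ?leq_maxl.
  apply: le_trans (ALmono _ _ (leq_maxr m n)).
  by rewrite lerDl ltW.
pose x := sup (range A).
have xP k : A k <= x <= A k + L k.
  apply/andP; split.
    by apply: ub_le_sup; [exists (A 0%N + L 0%N) => _ [n _ <-] | exists k].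
  by apply: ge_sup; [exists (A 0%N); exists 0%N | move=> _ [n _ <-]].
exists x; split.
- move=> K; have [Q [q [p [KQ qQ _ _ [h1 h2]]]]] := AL K.
  exists Q, q, p; split => //; first exact: ltnW.
  have := xP K.+1; rewrite h1 h2 => /andP[h3 h4]; apply/andP; split; lra.
- by have := xP 0%N; rewrite A0 L0.
- move=> i; rewrite ltNge; apply/negP; rewrite ler_distl => /andP[h1 h2].
  have mi k : meets y r (A k) (L k) i.
    have /andP[h3 h4] := xP k.
    by rewrite /meets (le_trans h1 h4) (le_trans h3 h2).
  have [N N0 NP] := natV_small (r0 i).
  have [Q [q [p [NQ _ _ _ [_ LE]]]]] := AL N.
  have [] := avoiding_weight d0 (Lgt N.+1) (Av N.+1) (mi N.+1).
  rewrite ler_pdivrMr // mul1r LE => rQ _.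
  have cr : r i <= c * r i by rewrite ler_peMl ?(ltW (r0 i)) //; lra.
  have Q0 : (0 < Q)%N by apply: leq_trans NQ.
  have := NP Q (ltnW NQ); have := powRN_tau_le tau2 Q0.
  have Q1 : (1 : R) <= Q%:R by rewrite ler1n.
  have := powR_ge0 Q%:R (- tau); have := r0 i.
  set w := _ `^ _ in rQ * => ri w0.
  have := ler_wpM2r w0 Q1; lra.
Qed.

Lemma sum_geometric_half e n : \sum_(0 <= k < n) e / 2 ^+ k.+1 = e * (1 - 2 ^- n).
Proof.
elim: n => [|n IHn]; first by rewrite big_geq // expr0 invr1 subrr mulr0.
rewrite big_nat_recr //= IHn exprS invfM; by field; rewrite expf_neq0.
Qed.

Lemma coverable_sub d A B : A `<=` B -> coverable d B -> @coverable R d A.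
Proof.
move=> AB cB e e0; have [y [r [r0 By re]]] := cB e e0.
by exists y, r; split => //; exact: subset_trans By.
Qed.

(** A cover of total d-weight at most (l/c)^d makes [a, a + l] an admissible start for
    [nested_avoiding], whose point belongs to the set but to no interval of the cover. *)
Lemma not_coverable_close_above d tau a l : 2 <= tau -> 0 < d -> d * tau < 2 ->
  0 < l -> ~ coverable d [set x | close_above tau x /\ a <= x <= a + l].
Proof.
move=> tau2 d0 dtau l0 cW; have [c c640] : exists c : R, 10 * 64 <= c by exists (10 * 64).
have c0 : 0 < c by lra.
pose e := (l / c) `^ d / 2.
have e0 : 0 < e by rewrite divr_gt0 // powR_gt0 // divr_gt0.
have [y [r [r0 Wy re]]] := cW e e0.
(* Radii may vanish, whereas [nested_avoiding] takes positive ones; enlarging them to at least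
   [eta k] costs at most e more, the other half of (l/c)^d. *)
pose eta k := (e / 2 ^+ k.+1) `^ d^-1.
have ek k : 0 < e / 2 ^+ k.+1 by rewrite divr_gt0 // exprn_gt0.
have eta0 k : 0 < eta k by rewrite powR_gt0.
have etad k : eta k `^ d = e / 2 ^+ k.+1.
  by rewrite -powRrM mulVf ?lt0r_neq0 // powRr1 // ltW.
pose r' k := Num.max (r k) (eta k).
have r'0 k : 0 < r' k by rewrite lt_max eta0 orbT.
have r'd k : r' k `^ d <= r k `^ d + e / 2 ^+ k.+1.
  rewrite -etad /r'; case: (leP (r k) (eta k)) => _; first by rewrite lerDr powR_ge0.
  by rewrite lerDl powR_ge0.
have av : avoiding y r' c d a l.
  move=> n; rewrite big_mkcond /=.
  apply: (@le_trans _ _ (\sum_(0 <= i < n) (c / l) `^ d * r' i `^ d)).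
    apply: ler_sum => i _; case: ifP => _; last by rewrite mulr_ge0 ?powR_ge0.
    rewrite /weight ge_min -powRM ?(ltW (r'0 i)) ?divr_ge0 ?(ltW l0) ?(ltW c0) //.
    by rewrite mulrAC lexx.
  rewrite -mulr_sumr.
  have : \sum_(0 <= i < n) r' i `^ d <= (l / c) `^ d.
    apply: (@le_trans _ _ (\sum_(0 <= k < n) (r k `^ d + e / 2 ^+ k.+1))).
      by apply: ler_sum => k _; exact: r'd.
    rewrite big_split /= sum_geometric_half.
    have h : 0 <= 2 ^- n :> R by rewrite invr_ge0 exprn_ge0.
    have := ler_wpM2l (ltW e0) h; have := re n.
    have -> : (l / c) `^ d = 2 * e by rewrite /e; field.
    lra.
  move=> /(ler_wpM2l (powR_ge0 (c / l) d)) /le_trans; apply.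
  rewrite -powRM ?divr_ge0 ?(ltW l0) ?(ltW c0) // (_ : c / l * (l / c) = 1); last first.
    by field; rewrite !gt_eqF.
  by rewrite powR1.
have [x [cx xl xr]] := nested_avoiding r'0 c640 tau2 d0 dtau l0 av.
have [k _ /=] := Wy x (conj cx xl); rewrite leNgt => /negP; apply.
by apply: le_lt_trans (xr k); rewrite le_max lexx.
Qed.

(** The strict increase of the exponent also covers d = 0: there each nonempty set has gauge 1, so
    content below 1 forces A to be empty. *)
Lemma hausdorff_measure0_coverable_lt d d' A : 0 <= d < d' ->
  hausdorff_measure d A = 0%E -> @coverable R d' A.
Proof.
move=> /andP[d0 dd'] HA; have [d00|d00|d00] := ltgtP 0 d; last 1 first.
- rewrite -d00 in HA.
  have : (hausdorff_content 0 1 A < 1)%E.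
    apply: le_lt_trans (_ : 0 < _)%E; last by rewrite lte_fin.
    by rewrite -HA; apply: ereal_sup_ubound; exists 1 => //=; exact: ltr01.
  move=> /ereal_inf_lt[_ [U [AU _] <-] U1].
  have A0 : A `<=` set0.
    move=> x /AU[k _ Ukx].
    have Uk : (1 <= hausdorff_gauge 0 (U k))%E.
      rewrite /hausdorff_gauge poweRe0; case: ifPn => // /eqP Uk0.
      by move: Ukx; rewrite Uk0.
    move: U1; rewrite ltNge => /negP; apply; apply: le_trans Uk _.
    apply: le_trans (nneseries_lim_ge k.+1 _).
      by rewrite big_nat_recr //= leeDr // sume_ge0 // => *; exact: hausdorff_gauge_ge0.
    by move=> *; exact: hausdorff_gauge_ge0.
  move=> e e0; exists (fun=> 0), (fun=> 0); split => // [x /A0 //|n].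
  by rewrite big1 ?(ltW e0) // => k _; rewrite powR0 // gt_eqF // d00.
(* A total of at most 1 keeps every radius at most 1, whence r^d' <= r^d. *)
- move=> e e0; have e'0 : 0 < Num.min e 1 by rewrite lt_min e0 ltr01.
  have [y [r [r0 Ay re]]] := hausdorff_measure0_coverable d00 HA e'0.
  exists y, r; split => // n; apply: le_trans (_ : Num.min e 1 <= e); last first.
    by rewrite ge_min lexx.
  apply: le_trans (re n); apply: ler_sum => k _.
  have [rk0|rk0] := eqVneq (r k) 0; first by rewrite rk0 !powR0 ?gt_eqF // (lt_trans d00).
  have rk : 0 < r k by rewrite lt_neqAle eq_sym rk0 r0.
  rewrite ger_powR ?(ltW dd') // rk leNgt; apply/negP => r1.
  have := re k.+1; rewrite big_nat_recr //= leNgt => /negP; apply.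
  rewrite gt_min; apply/orP; right; apply: lt_le_trans (_ : r k `^ d <= _).
    have p1 : 1 `^ d = 1 :> R by rewrite powR1.
    by rewrite -[ltLHS]p1 gt0_ltr_powR ?nnegrE // ltW.
  by rewrite lerDr sumr_ge0 // => *; exact: powR_ge0.
- by move: d00; rewrite ltNge d0.
Qed.

End LowerBound.

(** * Dimension, density and the case s <= t for the divergence set *)

Section Dimension.
Context {R : realType}.
Implicit Types (s t d tau sigma l : R) (A : set R).

Lemma hausdorff_dim_eq A b : 0 <= b ->
  (forall d, b < d -> hausdorff_measure d A = 0%E) ->
  (forall d, 0 <= d -> hausdorff_measure d A = 0%E -> b <= d) ->
  hausdorff_dim A = b%:E.
Proof.
move=> b0 up low; apply/eqP; rewrite eq_le; apply/andP; split; last first.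
  by apply: le_ereal_inf_tmp => _ [d [d0 Hd] <-]; rewrite lee_fin low.
apply/lee_addgt0Pr => e e0; apply: ereal_inf_lbound.
exists (b + e) => //; split; first by rewrite addr_ge0 // ltW.
by apply: up; rewrite ltrDl.
Qed.

Lemma sine_div_close_above s t tau : 0 < s -> 1 < t -> 2 <= tau ->
  1 + s / t <= tau -> close_above tau `<=` sine_div_set s t.
Proof.
move=> s0 t1 tau2 st x cx.
apply: approximable_sine_div => //; first exact: close_above_irrational cx.
apply: approximable_sub (close_above_approximable tau2 cx); lra.
Qed.

Lemma sine_div_dim_lower s t tau d : 0 < s -> 1 < t -> 2 <= tau ->
  1 + s / t <= tau -> 0 <= d -> hausdorff_measure d (sine_div_set s t) = 0%E ->
  2 / tau <= d.
Proof.
move=> s0 t1 tau2 st d0 HD; rewrite leNgt; apply/negP => lt.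
have tau0 : 0 < tau by lra.
(* The midpoint is positive even if d = 0, and still satisfies d' tau < 2. *)
pose d' := (d + 2 / tau) / 2.
have dd' : 0 <= d < d' by rewrite d0 /d'; lra.
have d'0 : 0 < d' by case/andP: dd' => _; exact: le_lt_trans.
have d'tau : d' * tau < 2 by rewrite -ltr_pdivlMr // /d'; lra.
apply: (not_coverable_close_above (a := 0) tau2 d'0 d'tau ltr01).
apply: coverable_sub (hausdorff_measure0_coverable_lt dd' HD).
by move=> x [cx _]; exact: sine_div_close_above cx.
Qed.

(** If an open set around x missed the divergence set, the points of [close_above] in [x, x + e/2]
    would form an empty, hence coverable, set. *)
Lemma dense_sine_div s t : 0 < s -> 1 < t -> dense (sine_div_set s t).
Proof.
move=> s0 t1 O [x Ox] oO.
have [e /= e0 xO] : nbhs_ball x O by rewrite nbhs_ballE; exact: open_nbhs_nbhs.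
pose tau := Num.max 2 (1 + s / t); pose d := tau^-1.
have tau2 : 2 <= tau by rewrite le_max lexx.
have tau0 : 0 < tau by lra.
have d0 : 0 < d by rewrite invr_gt0.
have dtau : d * tau < 2 by rewrite mulVf ?gt_eqF //; lra.
have e20 : 0 < e / 2 by rewrite divr_gt0.
have := not_coverable_close_above (a := x) tau2 d0 dtau e20.
apply: contra_notP => /set0P/negP; rewrite negbK => /eqP OD0.
apply: coverable_sub (_ : _ `<=` set0) _ => [z [cz /andP[xz zx]]|].
  rewrite -OD0; split; last by apply: sine_div_close_above cz;
    rewrite // le_max lexx orbT.
  by apply: xO; rewrite /ball /= ltr_norml; apply/andP; split; lra.
move=> e' e'0; exists (fun=> 0), (fun=> 0); split => // n.
by rewrite big1 ?(ltW e'0) // => k _; rewrite powR0 // gt_eqF.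
Qed.

(** Dirichlet's exponent 1 already reaches s/t. *)
Lemma sine_div_irrational s t : 0 < s -> 1 < t -> s <= t ->
  sine_div_set s t = @irrational R.
Proof.
move=> s0 t1 st; apply/seteqP; split => [x []//|x irrx].
apply: approximable_sine_div => //.
apply: approximable_sub (irrational_approximable irrx).
by rewrite ler_pdivrMr ?mul1r //; lra.
Qed.

Lemma sine_div_coverable s t d : 0 < s -> 1 < t ->
  2 / Num.max 2 (1 + s / t) < d -> coverable d (sine_div_set s t).
Proof.
move=> s0 t1; have t0 : 0 < t by lra.
have st0 : 0 < s / t by rewrite divr_gt0.
have [st|ts] := leP s t.
  have -> : Num.max 2 (1 + s / t) = 2.
    have h : s / t <= 1 by rewrite ler_pdivrMr ?mul1r.
    by apply/max_idPl; lra.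
  rewrite divff // => d1; rewrite sine_div_irrational //.
  apply: coverable_sub (approximable_coverable (sigma := 1) _ _ _) => //; try lra.
  exact: irrational_approximable.
have st1 : 1 < s / t by rewrite ltr_pdivlMr ?mul1r.
have -> : Num.max 2 (1 + s / t) = 1 + s / t by apply/max_idPr; lra.
move=> hd; have d0 : 0 < d by apply: lt_trans hd; rewrite divr_gt0 //; lra.
(* The midpoint of 2/d - 1 and s/t, cut off at 0: large enough for 2 < (1 + sigma) d, small enough
   for sigma t < s. *)
pose sigma := Num.max 0 ((2 / d - 1 + s / t) / 2).
have h : 2 / d < 1 + s / t.
  by move: hd; rewrite ltr_pdivrMr ?addr_gt0 // => hd; rewrite ltr_pdivrMr // mulrC.
have sig : sigma < s / t by rewrite /sigma gt_max st0 /=; lra.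
have sig0 : 0 <= sigma by rewrite le_max lexx.
have sigd : 2 < (1 + sigma) * d.
  rewrite -ltr_pdivrMr //; have : (2 / d - 1 + s / t) / 2 <= sigma.
    by rewrite le_max lexx orbT.
  lra.
apply: coverable_sub (approximable_coverable d0 sig0 sigd).
by apply: sine_div_approximable => //; rewrite -ltr_pdivlMr.
Qed.

Lemma min_dimE s t : 0 < s -> 0 < t ->
  2 / Num.max 2 (1 + s / t) = Num.min 1 (2 * t / (s + t)).
Proof.
move=> s0 t0; have stt : 2 * t / (s + t) = 2 / (1 + s / t).
  by field; rewrite !gt_eqF // addr_gt0.
have st0 : 0 < s / t by rewrite divr_gt0.
rewrite stt; have [st|ts] := leP s t.
  have h : 1 + s / t <= 2.
    have : s / t <= 1 by rewrite ler_pdivrMr ?mul1r.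
    lra.
  rewrite (max_idPl h) divff //; apply/esym/min_idPl.
  by rewrite ler_pdivlMr ?addr_gt0 // mul1r.
have h : 2 <= 1 + s / t.
  have : 1 < s / t by rewrite ltr_pdivlMr ?mul1r.
  lra.
rewrite (max_idPr h); apply/esym/min_idPr.
by rewrite ler_pdivrMr ?addr_gt0 // mul1r.
Qed.

Lemma sine_div_dim s t : 0 < s -> 1 < t ->
  hausdorff_dim (sine_div_set s t) = (Num.min 1 (2 * t / (s + t)))%:E.
Proof.
move=> s0 t1; rewrite -min_dimE //; last lra.
have tau2 : 2 <= Num.max 2 (1 + s / t) by rewrite le_max lexx.
apply: hausdorff_dim_eq => [|d dd|d d0].
- by rewrite divr_ge0 // (le_trans _ tau2).
- apply: coverable_hausdorff_measure0; last exact: sine_div_coverable.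
  by apply: le_lt_trans dd; rewrite divr_ge0 // (le_trans _ tau2).
- by apply: sine_div_dim_lower => //; rewrite le_max lexx orbT.
Qed.

End Dimension.
Theorem theorem4p1 (R : realType) :
  (forall s t : R, 1 < t -> 0 < s ->
    [/\ hausdorff_dim (sine_div_set s t) = (Num.min 1 (2 * t / (s + t)))%:E,
        s <= t -> sine_div_set s t = @irrational R
      & t < s ->
        [/\ dense (sine_div_set s t),
            lebesgue_measure (sine_div_set s t) = 0%E,
            hausdorff_dim (sine_div_set s t) = (2 * t / (s + t))%:E
          & 0 < 2 * t / (s + t) < 1]])
  /\ hausdorff_dim (sine_div_set (3 : R) (2 : R)) = (4 / 5 : R)%:E.
Proof.
have main (s t : R) : 1 < t -> 0 < s ->
    hausdorff_dim (sine_div_set s t) = (Num.min 1 (2 * t / (s + t)))%:E.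
  by move=> t1 s0; exact: sine_div_dim.
split=> [s t t1 s0|]; last first.
  rewrite main ?ltr1n //; congr (_%:E).
  rewrite (_ : 2 * 2 / (3 + 2) = 4 / 5 :> R); last by field.
  by apply/min_idPr; lra.
split; [exact: main | exact: sine_div_irrational | move=> ts].
have t0 : 0 < t by lra.
have dim01 : 0 < 2 * t / (s + t) < 1.
  by rewrite divr_gt0 ?mulr_gt0 ?addr_gt0 // ltr_pdivrMr ?addr_gt0 // mul1r; lra.
split => //.
- exact: dense_sine_div.
(* The dimension is below 1, so the cover bound applies with exponent 1. *)
- apply/coverable1_lebesgue_measure0/sine_div_coverable => //.
  rewrite min_dimE // gt_min; apply/orP; right; by case/andP: dim01.
- rewrite main //; congr (_%:E); apply/min_idPr/ltW; by case/andP: dim01.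
Qed.
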